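(* Let $A\neq0$ be a scalar type spectral operator in a complex infinite-dimensional Banach space $X$. Then $A$ generates an immediately compact $C_0$-semigroup on $X$ if and only if $\sigma(A)$ is a countably infinite set of eigenvalues of $A$ with finite geometric multiplicities, which has no finite limit points and is such that, for an arbitrary arrangement $\{\lambda_n\}_{n=1}^\infty$ of $\sigma(A)$, $$\operatorname{Re}\lambda_n\to-\infty,\quad n\to\infty.$$
   Context: A scalar type spectral operator in a complex Banach space $X$ is a densely defined closed linear operator $A$ in $X$ for which there is a strongly $\sigma$-additive spectral measure $E_A(\cdot)$ (the resolution of the identity), assigning to Borel subsets of $\mathbb{C}$ bounded projection operators on $X$ (with $E_A(\emptyset)=0$, $E_A(\mathbb{C})=I$, $E_A(\delta\cap\delta')=E_A(\delta)E_A(\delta')$), whose support is the spectrum $\sigma(A)$, and such that $A=\int_{\sigma(A)}\lambda\,dE_A(\lambda)$. Here, for a Borel measurable $F:\sigma(A)\to\mathbb{C}$, $F(A)=\int_{\sigma(A)}F(\lambda)\,dE_A(\lambda)$ is the operator $F(A)f=\lim_{n\to\infty}\int_{\{|F|\le n\}}F(\lambda)\,dE_A(\lambda)f$, with domain all $f\in X$ for which the limit exists. A $C_0$-semigroup $\{T(t)\}_{t\ge0}$ is immediately compact if $T(t)$ is a compact operator for every $t>0$. The geometric multiplicity of an eigenvalue $\lambda$ of $A$ is $\dim\ker(A-\lambda I)$. An arrangement of a countably infinite set $S$ is a bijection $\mathbb{N}\ni n\mapsto\lambda_n\in S$, with $\mathbb{N}=\{1,2,\dots\}$. *)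

(* Defs.v *)
From HB Require Import structures.
From mathcomp Require Import all_boot all_order all_algebra.
From mathcomp Require Import all_classical all_reals all_analysis.
From mathcomp Require Import complex.

Set Implicit Arguments.
Unset Strict Implicit.
Unset Printing Implicit Defensive.

Import Order.TTheory GRing.Theory Num.Theory.
Import numFieldTopology.Exports numFieldNormedType.Exports.

Local Open Scope classical_set_scope.
Local Open Scope ring_scope.
Local Open Scope complex_scope.

(* R[i] packed as a numClosedFieldType: it is through this structure that
   MathComp-Analysis equips a numeric field with its norm topology. *)
Definition cplx (R : realType) : numClosedFieldType := R[i].

Definition ofreal (R : realType) (x : R) : cplx R := x%:C.

Definition borelC (R : realType) := g_sigma_algebraType (@open (cplx R)).

Section LinearAlgebra.
Context {K : fieldType} {X : lmodType K}.

Definition fin_dim (V : set X) : Prop :=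
  exists (n : nat) (e : 'I_n -> X),
    V = range (fun c : 'I_n -> K => \sum_(i < n) c i *: e i).

End LinearAlgebra.

Section Operators.
Context {R : realType} {X : completeNormedModType (cplx R)}.
Local Notation C := (cplx R).

(* A linear operator in X with domain [dom A]; the values of the underlying
   function outside of [dom A] are irrelevant. *)
Record operator := Operator {
  dom : set X;
  app :> X -> X;
  dom_zero : dom 0;
  dom_lin : forall (a : C) x y, dom x -> dom y -> dom (a *: x + y);
  app_lin : forall (a : C) x y, dom x -> dom y ->
    app (a *: x + y) = a *: app x + app y
}.

Definition op_graph (A : operator) : set (X * X) :=
  [set p | dom A p.1 /\ A p.1 = p.2].

Definition nonzero_op (A : operator) : Prop := exists2 f, dom A f & A f <> 0.

Definition densely_defined (A : operator) : Prop := dense (dom A).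

Definition closed_op (A : operator) : Prop := closed (op_graph A).

Definition resolvent_set (A : operator) : set C :=
  [set z | exists B : {linear X -> X},
    [/\ continuous B,
        forall g, dom A (B g) /\ A (B g) - z *: B g = g
      & forall f, dom A f -> B (A f - z *: f) = f]].

Definition spectrum (A : operator) : set C := ~` resolvent_set A.

(* ker (A - z I) *)
Definition op_eigenspace (A : operator) (z : C) : set X :=
  [set f | dom A f /\ A f - z *: f = 0].

Definition op_eigenvalue (A : operator) (z : C) : Prop :=
  exists2 f, op_eigenspace A z f & f <> 0.

Definition compact_op (T : X -> X) : Prop :=
  forall B : set X, bounded_set B -> precompact (T @` B).

Definition C0_semigroup (T : R -> {linear X -> X}) : Prop :=
  [/\ forall t, 0 <= t -> continuous (T t),
      forall f, T 0 f = f,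
      forall s t f, 0 <= s -> 0 <= t -> T (s + t) f = T s (T t f)
    & forall f, T t f @[t --> 0^'+] --> f].

Definition immediately_compact (T : R -> {linear X -> X}) : Prop :=
  forall t, 0 < t -> compact_op (T t).

(* A is the generator of T: A f is the limit of (T(t)f - f)/t as t -> 0+, and
   the domain of A consists of all f for which that limit exists. *)
Definition generator (A : operator) (T : R -> {linear X -> X}) : Prop :=
  forall f g, op_graph A (f, g) <->
    (ofreal t^-1 *: (T t f - f)) @[t --> 0^'+] --> g.

(* Only the values of E at Borel sets are meaningful. *)
Definition spectral_measure (E : set C -> {linear X -> X}) : Prop :=
  [/\ forall D : set (borelC R), measurable D ->
        continuous (E D) /\ forall f, E D (E D f) = E D f,
      (forall f, E set0 f = 0) /\ (forall f, E setT f = f),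
      forall D D' : set (borelC R), measurable D -> measurable D' ->
        forall f, E (D `&` D') f = E D (E D' f)
    & forall D : (set (borelC R))^nat,
        (forall n, measurable (D n)) -> trivIset setT D ->
        forall f, (\sum_(0 <= i < n) E (D i) f) @[n --> \oo]
                    --> E (\bigcup_n D n) f].

Definition spectral_support (E : set C -> {linear X -> X}) : set C :=
  [set z | forall U : set C, open U -> U z -> exists f, E U f <> 0].

Definition simple_function (s : C -> C) : Prop :=
  finite_set (range s) /\ measurable_fun setT (s : borelC R -> borelC R).

Definition simple_integral (E : set C -> {linear X -> X}) (s : C -> C)
    (f : X) : X :=
  \sum_(z \in range s) z *: E (s @^-1` [set z]) f.

(* y = (\int F dE) f for a bounded Borel function F, the integral being the
   limit of the integrals of Borel simple functions converging uniformly
   to F. *)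
Definition is_bounded_integral (E : set C -> {linear X -> X}) (F : C -> C)
    (f y : X) : Prop :=
  exists s : nat -> C -> C,
    [/\ forall n, simple_function (s n),
        forall e : R, 0 < e -> \forall n \near \oo,
          forall z, `|s n z - F z| < ofreal e
      & simple_integral E (s n) f @[n --> \oo] --> y].

(* f belongs to the domain of \int_S F dE, and y is its image;
   [F \_ S] is F on S and 0 outside of S. *)
Definition is_spectral_integral (E : set C -> {linear X -> X}) (S : set C)
    (F : C -> C) (f y : X) : Prop :=
  exists u : nat -> X,
    (forall n, is_bounded_integral E
       (F \_ (S `&` [set z | `|F z| <= n%:R])) f (u n)) /\
    u n @[n --> \oo] --> y.

Definition scalar_type_spectral (A : operator) : Prop :=
  [/\ densely_defined A,
      closed_op A
    & exists E : set C -> {linear X -> X},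
        [/\ spectral_measure E,
            spectral_support E = spectrum A
          & forall f y, op_graph A (f, y) <->
              is_spectral_integral E (spectrum A) id f y]].

End Operators.

Arguments operator {R} X.

(* An arrangement of S, the index set being {1, 2, 3, ...}; the value at 0 is
   irrelevant. *)
Definition arrangement (T : Type) (S : set T) (l : nat -> T) : Prop :=
  set_bij [set n | (0 < n)%N] S l.

(* Main.v *)
(** Write E for the spectral measure and S for the spectrum, which
    is the support of E.  A vector measure is bounded, so the projections E(D)
    are uniformly bounded and |sum a_i E(D_i) f| <= 4 M sup|a_i| |f| for disjoint
    D_i.

    Necessity.  Telescoping the semigroup law gives, for small d > 0 and every f
    in the domain of A, |T(d) f - e^(d l) f| <= C_l |A f - l f|.  If infinitely
    many points l_n of S had real part >= c, choose pairwise disjoint open V_n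
    containing l_n, so small that unit vectors f_n in the range of E(V_n) satisfy
    T(d) f_n = e^(d l_n) f_n up to a small error; applying E(V_n) shows that the
    T(d) f_n are separated, which contradicts compactness.  Hence S meets every
    right half-plane in a finite set.  The eigenspaces are finite-dimensional by
    Riesz's lemma, and S is infinite because X is not finite-dimensional.

    Sufficiency.  With P_n = E({l_n}), every f is the sum of the P_n f, and
    (f, g) is in the graph of A iff P_n g = l_n P_n f for all n.  Every bounded
    sequence m defines an operator by P_n (B f) = m_n P_n f.  The semigroup is
    given by m_n = e^(t l_n), and T(t) is compact because this sequence tends
    to 0 and the P_n have finite rank. *)

Require Import Defs.
From HB Require Import structures.
From mathcomp Require Import all_boot all_order all_algebra.
From mathcomp Require Import all_classical all_reals all_analysis.
From mathcomp Require Import complex ring lra.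

Set Implicit Arguments.
Unset Strict Implicit.
Unset Printing Implicit Defensive.

Import Order.TTheory GRing.Theory Num.Theory.
Import numFieldTopology.Exports numFieldNormedType.Exports.

Local Open Scope classical_set_scope.
Local Open Scope ring_scope.

(** * Real-valued norms and the complex exponential *)

Section RealNorm.
Context {R : realType}.
Local Notation C := (cplx R).

(** Norms over [C] are themselves complex numbers. Being nonnegative they are real, so no
    information is lost ([nrmE]), and all estimates can be carried out in the ordered field [R]. *)
Definition nrm {V : normedZmodType C} (x : V) : R := complex.Re `|x|.

Lemma ofrealD (a b : R) : ofreal (a + b) = ofreal a + ofreal b.
Proof. by rewrite /ofreal rmorphD. Qed.
Lemma ofrealM (a b : R) : ofreal (a * b) = ofreal a * ofreal b.
Proof. by rewrite /ofreal rmorphM. Qed.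
Lemma ofreal_le (a b : R) : (ofreal a <= ofreal b) = (a <= b).
Proof. exact: lecR. Qed.
Lemma ofreal_lt (a b : R) : (ofreal a < ofreal b) = (a < b).
Proof. exact: ltcR. Qed.
Lemma ge0_ofreal (z : C) : 0 <= z -> z = ofreal (complex.Re z).
Proof.
by case: z => x y; rewrite lecE /= => /andP[/eqP -> _].
Qed.

Section Zmod.
Context {V : normedZmodType C}.
Implicit Types x y : V.

Lemma nrmE x : `|x| = ofreal (nrm x).
Proof. exact: ge0_ofreal. Qed.
Lemma nrm_ge0 x : 0 <= nrm x.
Proof. by rewrite -ofreal_le -nrmE normr_ge0. Qed.
Lemma nrm0 : nrm (0 : V) = 0.
Proof. by rewrite /nrm normr0. Qed.
Lemma nrm0_eq0 x : nrm x = 0 -> x = 0.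
Proof. by move=> h; apply: normr0_eq0; rewrite nrmE h. Qed.
Lemma nrm_gt0 x : x != 0 -> 0 < nrm x.
Proof.
move=> x0; rewrite lt_def nrm_ge0 andbT; apply: contra x0 => /eqP.
by move/nrm0_eq0 => ->.
Qed.
Lemma nrmN x : nrm (- x) = nrm x.
Proof. by rewrite /nrm normrN. Qed.
Lemma nrm_distC x y : nrm (x - y) = nrm (y - x).
Proof. by rewrite /nrm distrC. Qed.
Lemma nrmD x y : nrm (x + y) <= nrm x + nrm y.
Proof. by rewrite -ofreal_le ofrealD -!nrmE ler_normD. Qed.
Lemma nrmB x y : nrm (x - y) <= nrm x + nrm y.
Proof. by rewrite -(nrmN y) nrmD. Qed.
Lemma nrm_distD z x y : nrm (x - y) <= nrm (x - z) + nrm (z - y).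
Proof. by apply: le_trans (nrmD _ _); rewrite addrA subrK. Qed.
Lemma nrm_sum (I : Type) (r : seq I) (P : pred I) (F : I -> V) :
  nrm (\sum_(i <- r | P i) F i) <= \sum_(i <- r | P i) nrm (F i).
Proof.
elim/big_ind2: _ => //; first by rewrite nrm0.
by move=> a b c d ab cd; apply: le_trans (nrmD _ _) (lerD ab cd).
Qed.
End Zmod.

Lemma nrmZ {V : normedModType C} (a : C) (x : V) :
  nrm (a *: x) = nrm a * nrm x.
Proof.
by have := normrZ a x; rewrite !nrmE -ofrealM => -[].
Qed.

Lemma nrmM (a b : C) : nrm (a * b) = nrm a * nrm b.
Proof.
by have := normrM a b; rewrite !nrmE -ofrealM => -[].
Qed.

Lemma nrm_ofreal (a : R) : nrm (ofreal a) = `|a|.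
Proof. by rewrite /nrm /ofreal normc_def /= expr0n addr0 sqrtr_sqr. Qed.

Lemma nrm1 : nrm (1 : C) = 1.
Proof. by rewrite /nrm normr1. Qed.

Lemma Re_le_nrm (z : C) : `|complex.Re z| <= nrm z.
Proof.
case: z => x y; rewrite /nrm normc_def /= -sqrtr_sqr ler_sqrt //.
  by rewrite lerDl sqr_ge0.
by rewrite addr_ge0 ?sqr_ge0.
Qed.
Lemma Im_le_nrm (z : C) : `|complex.Im z| <= nrm z.
Proof.
case: z => x y; rewrite /nrm normc_def /= -sqrtr_sqr ler_sqrt //.
  by rewrite lerDr sqr_ge0.
by rewrite addr_ge0 ?sqr_ge0.
Qed.
Lemma nrm_le_ReIm (z : C) : nrm z <= `|complex.Re z| + `|complex.Im z|.
Proof.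
case: z => x y; rewrite /nrm normc_def /=.
rewrite -[leRHS]ger0_norm ?addr_ge0// -sqrtr_sqr ler_sqrt ?sqr_ge0//.
rewrite sqrrD !real_normK ?num_real// lerD2r lerDl.
by rewrite mulrn_wge0 ?mulr_ge0.
Qed.

Lemma cvg_nrm {V : pseudoMetricNormedZmodType C} {T : Type} (F : set_system T)
    {FF : Filter F} (f : T -> V) (y : V) :
  f x @[x --> F] --> y <->
  forall e : R, 0 < e -> \forall x \near F, nrm (f x - y) < e.
Proof.
split=> [/cvgrPdist_lt h e e0|h].
  have /h : 0 < ofreal e by rewrite (ofreal_lt 0).
  by apply: filterS => x; rewrite nrmE ofreal_lt nrm_distC.
apply/cvgrPdist_lt => e e0; have ee := ge0_ofreal (ltW e0).
have /h : 0 < complex.Re e by rewrite -ofreal_lt -ee.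
by apply: filterS => x; rewrite nrmE {2}ee ofreal_lt nrm_distC.
Qed.


Definition cexp (z : C) : C :=
  (expR (complex.Re z) * cos (complex.Im z) +i*
   (expR (complex.Re z) * sin (complex.Im z)))%C.

Lemma nrm_cexp (z : C) : nrm (cexp z) = expR (complex.Re z).
Proof.
rewrite /nrm normc_def /= !exprMn -mulrDr cos2Dsin2 mulr1 sqrtr_sqr.
by rewrite ger0_norm ?expR_ge0.
Qed.

Lemma cexp_neq0 (z : C) : cexp z != 0.
Proof.
by apply/eqP => h; have := expR_gt0 (complex.Re z); rewrite -nrm_cexp h nrm0 ltxx.
Qed.

Lemma cexpD (z w : C) : cexp (z + w) = cexp z * cexp w.
Proof.
case: z w => a b [c d]; rewrite /cexp /= expRD cosD sinD.
by apply/eqP; rewrite eq_complex /=; apply/andP; split; apply/eqP; ring.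
Qed.

Lemma cexp0 : cexp 0 = 1.
Proof.
by rewrite /cexp /= expR0 cos0 sin0 !mul1r.
Qed.

Lemma cexpMn (z : C) n : cexp (z *+ n) = cexp z ^+ n.
Proof. by elim: n => [|n IH]; rewrite ?mulr0n ?cexp0 // mulrS cexpD IH exprS. Qed.

Lemma is_derive_quotient (g : R -> R) (a : R) : is_derive (0 : R) 1 g a ->
  (t^-1 * (g t - g 0)) @[t --> 0^'+] --> a.
Proof.
move=> [d <-]; move: d => /cvgrPdist_lt d; apply/cvgrPdist_lt => e /d {}d.
apply: (@filterS _ (nbhs (0 : R)) _ _ _ _ d) => t h t0.
have := h (lt0r_neq0 t0).
by rewrite /= /GRing.scale /= mulr1 addr0.
Qed.

Lemma cexp_derive0 (z : C) :
  (ofreal t^-1 * (cexp (ofreal t * z) - 1)) @[t --> 0^'+] --> z.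
Proof.
case: z => a b.
have h1 : is_derive (0 : R) 1 (fun t => expR (t * a) * cos (t * b)) a.
  apply: is_derive_eq; rewrite /GRing.scale /= !mul0r expR0 cos0 sin0; ring.
have h2 : is_derive (0 : R) 1 (fun t => expR (t * a) * sin (t * b)) b.
  apply: is_derive_eq; rewrite /GRing.scale /= !mul0r expR0 cos0 sin0; ring.
have /cvgrPdist_lt k1 := is_derive_quotient h1.
have /cvgrPdist_lt k2 := is_derive_quotient h2.
apply/cvg_nrm => e e0; near=> t.
apply: le_lt_trans (nrm_le_ReIm _) _.
have l1 : `|a - (t^-1 * (expR (t * a) * cos (t * b) - expR (0 * a) * cos (0 * b)))| < e / 2.
  by near: t; apply: k1; rewrite divr_gt0.
have l2 : `|b - (t^-1 * (expR (t * a) * sin (t * b) - expR (0 * a) * sin (0 * b)))| < e / 2.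
  by near: t; apply: k2; rewrite divr_gt0.
rewrite [ltRHS]splitr; apply: ltrD.
  rewrite distrC; apply: le_lt_trans l1.
  rewrite le_eqVlt; apply/orP; left; apply/eqP; congr (`|_|) => /=.
  by rewrite !mul0r expR0 cos0 mulr1 !subr0 !addr0.
rewrite distrC; apply: le_lt_trans l2.
rewrite le_eqVlt; apply/orP; left; apply/eqP; congr (`|_|) => /=.
by rewrite !mul0r sin0 mulr0 !subr0 !addr0.
Unshelve. all: by end_near. Qed.

Lemma le_norm_MVT0 (f df : R -> R) (y : R) :
  (forall x, is_derive x (1 : R) f (df x)) -> (forall x, `|df x| <= 1) ->
  `|f y - f 0| <= `|y|.
Proof.
move=> hd hb.
have cf : continuous f by move=> x; apply/differentiable_continuous/derivable1_diffP.
have [y0|y0] := leP 0 y.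
  have [|c _ ->] := @MVT_segment R f df 0 y y0 (fun x _ => hd x).
    exact: continuous_subspaceT.
  by rewrite subr0 normrM ler_piMl.
have [|c _ h] := @MVT_segment R f df y 0 (ltW y0) (fun x _ => hd x).
  exact: continuous_subspaceT.
by rewrite distrC h sub0r normrM normrN ler_piMl.
Qed.

(** With z = x + iy, write e^x cos y - 1 = (e^x - 1) + e^x (cos y - 1). Each of |e^x - 1|, e^x |cos
    y - 1| and e^x |sin y| is at most max(1, e^x) |z|, whence the factor 3. The bound is linear in
    |z|, and its constant depends only on an upper bound for the real part. *)
Lemma nrm_cexpB1 (z : C) :
  nrm (cexp z - 1) <= 3 * expR (Num.max 0 (complex.Re z)) * nrm z.
Proof.
case: z => x y; apply: le_trans (nrm_le_ReIm _) _ => /=.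
set E := expR (Num.max 0 x).
have hx : `|x| <= nrm (x +i* y : C)%C by exact: Re_le_nrm (x +i* y)%C.
have hy : `|y| <= nrm (x +i* y : C)%C by exact: Im_le_nrm (x +i* y)%C.
have E1 : 1 <= E by rewrite -expR0 ler_expR le_max lexx.
have eE : expR x <= E by rewrite ler_expR le_max lexx orbT.
have e0 := expR_gt0 x.
have b1 : `|expR x - 1| <= E * `|x|.
  have [x0|x0] := leP 0 x.
    have -> : E = expR x by rewrite /E (max_idPr x0).
    have l1 : 1 <= expR x by rewrite -expR0 ler_expR.
    rewrite !ger0_norm ?subr_ge0//.
    have : (1 - x) * expR x <= 1.
      by rewrite -ler_pdivlMr// div1r -expRN; exact: expR_ge1Dx.
    by rewrite mulrBl mul1r (mulrC x) lerBlDr lerBlDr addrC.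
  have := expR_ge1Dx x => h.
  have l1 : expR x < 1 by rewrite -expR0 ltr_expR.
  by rewrite !ltr0_norm ?subr_lt0//; nra.
have b2 : `|cos y - 1| <= `|y|.
  rewrite -cos0; apply: (@le_norm_MVT0 _ (fun x => - sin x)).
  by move=> t; rewrite normrN ler_norml sin_geN1 sin_le1.
have b3 : `|sin y| <= `|y|.
  rewrite -[sin y]subr0 -sin0; apply: (@le_norm_MVT0 _ cos).
  by move=> t; rewrite ler_norml cos_geN1 cos_le1.
have c1 : `|expR x * cos y - 1| <= `|expR x - 1| + expR x * `|cos y - 1|.
  rewrite -{3}(ger0_norm (ltW e0)) -normrM; apply: le_trans (ler_normD _ _).
  by rewrite le_eqVlt; apply/orP; left; apply/eqP; congr (`|_|); ring.
have c2 : `|expR x * sin y - 0| <= expR x * `|sin y|.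
  by rewrite subr0 normrM (ger0_norm (ltW e0)).
have n1 := normr_ge0 (cos y - 1). have n2 := normr_ge0 (sin y). 
have n3 := normr_ge0 y. have n4 := normr_ge0 x.
nra.
Qed.

Lemma cauchyX {X : completeNormedModType C} (u : nat -> X) :
  (forall e : R, 0 < e -> exists N, forall n, (N <= n)%N -> nrm (u n - u N) <= e) ->
  exists a : X, u n @[n --> \oo] --> a.
Proof.
move=> h; suff /cauchy_cvg /cvg_ex [a ha] : cauchy (u n @[n --> \oo]) by exists a.
apply: cauchy_exP => e e0; have ee := ge0_ofreal (ltW e0).
have e1 : 0 < complex.Re e by rewrite -ofreal_lt -ee.
have [|N hN] := h (complex.Re e / 2); first by rewrite divr_gt0.
exists (u N); exists N => // n /= /hN k.
rewrite -ball_normE /ball_ /= nrmE ee ofreal_lt nrm_distC; apply: le_lt_trans k _.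
by rewrite ltr_pdivrMr// ltr_pMr// ltr1n.
Qed.

Lemma cauchyR (u : nat -> R) :
  (forall e : R, 0 < e -> exists N, forall n, (N <= n)%N -> `|u n - u N| <= e) ->
  exists a : R, u n @[n --> \oo] --> a.
Proof.
move=> h; suff /cauchy_cvg /cvg_ex [a ha] : cauchy (u n @[n --> \oo]) by exists a.
apply: cauchy_exP => e e0.
have [|N hN] := h (e / 2); first by rewrite divr_gt0.
exists (u N); exists N => // n /= /hN k.
rewrite -ball_normE /ball_ /= distrC; apply: le_lt_trans k _.
by rewrite ltr_pdivrMr// ltr_pMr// ltr1n.
Qed.

(** Completeness of [C] is derived from that of [R], applied to real and imaginary parts. *)
Lemma cauchyC (u : nat -> C) :
  (forall e : R, 0 < e -> exists N, forall n, (N <= n)%N -> nrm (u n - u N) <= e) ->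
  exists a : C, u n @[n --> \oo] --> a.
Proof.
move=> h.
have [a /cvgrPdist_lt ha] : exists a : R, complex.Re (u n) @[n --> \oo] --> a.
  apply: cauchyR => e /h[N hN]; exists N => n /hN; apply: le_trans.
  by have := Re_le_nrm (u n - u N); case: (u n) (u N) => [? ?] [? ?].
have [b /cvgrPdist_lt hb] : exists b : R, complex.Im (u n) @[n --> \oo] --> b.
  apply: cauchyR => e /h[N hN]; exists N => n /hN; apply: le_trans.
  by have := Im_le_nrm (u n - u N); case: (u n) (u N) => [? ?] [? ?].
exists (a +i* b)%C; apply/cvg_nrm => e e0.
have e2 : 0 < e / 2 by rewrite divr_gt0.
apply: filterS2 (ha _ e2) (hb _ e2) => n; rewrite distrC => h1; rewrite distrC => h2.
apply: le_lt_trans (nrm_le_ReIm _) _; rewrite [ltRHS]splitr.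
by case: (u n) h1 h2 => x y /= h1 h2; exact: ltrD.
Qed.

End RealNorm.

(** * The uniform boundedness principle over complex scalars *)

Section UniformBoundedness.
Context {R : realType} {X : completeNormedModType (cplx R)}.
Local Notation C := (cplx R).

Lemma nbhs_nrm {V : pseudoMetricNormedZmodType C} (x : V) (A : set V) :
  nbhs x A <-> exists2 e : R, 0 < e & forall y, nrm (y - x) < e -> A y.
Proof.
split=> [/nbhs_ballP[e /= e0 h]|[e e0 h]].
  have ee := ge0_ofreal (ltW e0); exists (complex.Re e).
    by rewrite -ofreal_lt -ee.
  by move=> y yx; apply: h; rewrite -ball_normE /= nrmE ee ofreal_lt nrm_distC.
apply/nbhs_ballP; exists (ofreal e) => /=; first by rewrite (ofreal_lt 0).
by move=> y /=; rewrite -ball_normE /= nrmE ofreal_lt nrm_distC; exact: h.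
Qed.

Lemma cvg_nrm_le {V : pseudoMetricNormedZmodType C} {T : Type} (F : set_system T)
    {FF : ProperFilter F} (f : T -> V) (y z : V) (K : R) :
  f x @[x --> F] --> y -> (\forall x \near F, nrm (f x - z) <= K) ->
  nrm (y - z) <= K.
Proof.
move=> /cvg_nrm fy fz; apply/ler_addgt0Pr => e e0.
have [x [h1 h2]] := filter_ex (filterI (fy _ e0) fz).
apply: le_trans (nrm_distD (f x) _ _) _; rewrite addrC.
by apply: lerD => //; rewrite nrm_distC ltW.
Qed.

Lemma cvg_nrm_unique {V : pseudoMetricNormedZmodType C} {T : Type} (F : set_system T)
    {FF : ProperFilter F} (f : T -> V) (y z : V) :
  f x @[x --> F] --> y -> f x @[x --> F] --> z -> y = z.
Proof.
move=> fy /cvg_nrm fz; apply/eqP; rewrite -subr_eq0; apply/eqP/nrm0_eq0.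
apply/eqP; rewrite eq_le nrm_ge0 andbT; apply/ler_addgt0Pr => e e0.
rewrite add0r; apply: (cvg_nrm_le fy).
by apply: filterS (fz _ e0) => x /ltW.
Qed.

(** A nonzero vector is rescaled to norm r / 2, which lies inside the open ball; this gives the
    factor 2. *)
Lemma homog_bound (B : {linear X -> X}) (r K : R) : 0 < r ->
  (forall y, nrm y < r -> nrm (B y) <= K) ->
  forall x, nrm (B x) <= 2 * K / r * nrm x.
Proof.
move=> r0 h x; have [->|x0] := eqVneq x 0; first by rewrite linear0 !nrm0 mulr0.
have n0 := nrm_gt0 x0; set a := r / 2 / nrm x.
have a0 : 0 < a by rewrite !divr_gt0.
have /h : nrm (ofreal a *: x) < r.
  rewrite nrmZ nrm_ofreal gtr0_norm// /a divfK ?gt_eqF//.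
  by rewrite ltr_pdivrMr// ltr_pMr// ltr1n.
rewrite linearZ /= nrmZ nrm_ofreal gtr0_norm// -ler_pdivlMl//.
move/le_trans; apply; rewrite /a le_eqVlt; apply/orP; left; apply/eqP.
by field; rewrite !gt_eqF.
Qed.

Lemma bound_continuous (B : {linear X -> X}) (K : R) :
  (forall x, nrm (B x) <= K * nrm x) -> continuous B.
Proof.
move=> h x; apply/cvg_nrm => e e0.
have K0 : 0 < `|K| + 1 by rewrite ltr_wpDl.
apply/nbhs_nrm; exists (e / (`|K| + 1)); first by rewrite divr_gt0.
move=> y; rewrite ltr_pdivlMr// mulrC; apply: le_lt_trans; rewrite -linearB.
apply: le_trans (h _) _; rewrite ler_wpM2r ?nrm_ge0//.
by rewrite ler_wpDr// ler_norm.
Qed.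

Lemma linear_cvg (B : {linear X -> X}) (T : Type) (F : set_system T) (FF : Filter F)
    (u : T -> X) y : continuous B ->
  u x @[x --> F] --> y -> B (u x) @[x --> F] --> B y.
Proof. by move=> cB uy; apply: cvg_comp uy _; exact: cB. Qed.

(* The library's Banach_Steinhauss is restricted to real scalars. *)
Lemma uniform_boundedness (I : Type) (B : I -> {linear X -> X}) :
  (forall i, continuous (B i)) -> (forall x, exists K, forall i, nrm (B i x) <= K) ->
  exists2 K, 0 <= K & forall i x, nrm (B i x) <= K * nrm x.
Proof.
move=> cB pB.
(* It suffices to bound all [B i] on one ball: a small y is the difference of x + y and x, both of
   which lie in that ball. *)
suff [n [x [r [r0 h]]]] : exists n x r, 0 < r /\
    forall i y, nrm (y - x) < r -> nrm (B i y) <= n.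
  have n0 (i : I) : 0 <= n.
    by have := h i x; rewrite subrr nrm0 => /(_ r0); apply: le_trans (nrm_ge0 _).
  exists (`|2 * (n + n) / r|) => // i z.
  apply: le_trans (ler_wpM2r (nrm_ge0 _) (ler_norm _)).
  apply: (homog_bound r0) => y yr.
  have -> : B i y = B i (x + y) - B i x by rewrite linearD addrAC subrr add0r.
  apply: le_trans (nrmB _ _) (lerD (h _ _ _) (h _ _ _)).
    by rewrite addrAC subrr add0r.
  by rewrite subrr nrm0.
apply: contrapT => hn.
(* Baire's argument by nested closed balls, coded as pairs of centre and radius. Inside a given ball
   there is a smaller one, of radius at most 1 / (n + 1), on all of which a single [B i] exceeds n
   in norm. *)
have step (np : nat * (X * R)) : exists q : X * R, 0 < np.2.2 ->
    [/\ 0 < q.2, q.2 <= np.1.+1%:R^-1,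
        forall y, nrm (y - q.1) <= q.2 -> nrm (y - np.2.1) <= np.2.2
      & exists i, forall y, nrm (y - q.1) <= q.2 -> np.1%:R < nrm (B i y)].
  case: np => n [x r] /=; have [r0|r0] := ltP 0 r; last by exists (x, r); rewrite ltNge r0.
  have [i [y [yx ny]]] : exists i y, nrm (y - x) < r /\ n%:R < nrm (B i y).
    apply: contrapT => h; apply: hn; exists n%:R, x, r; split=> // i y yr.
    by rewrite leNgt; apply/negP => ?; apply: h; exists i, y.
  have d0 : 0 < nrm (B i y) - n%:R by rewrite subr_gt0.
  have /cvg_nrm /(_ _ d0) /nbhs_nrm[s s0 hs] := cB i y.
  (* The three bounds keep the closed ball within the continuity radius s, make the radii tend to 0,
     and keep it inside the previous ball. *)
  pose t := Num.min (Num.min (s / 2) (n.+1%:R^-1)) (r - nrm (y - x)).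
  have ts : t <= s / 2 by rewrite !ge_min lexx.
  have tn : t <= n.+1%:R^-1 by rewrite !ge_min lexx orbT.
  have tr : t <= r - nrm (y - x) by rewrite !ge_min lexx orbT.
  exists (y, t) => _ /=; split => //.
  - by rewrite !lt_min divr_gt0//= invr_gt0 ltr0n subr_gt0.
  - move=> z zy; apply: le_trans (nrm_distD y _ _) _.
    by rewrite -lerBrDr; apply: le_trans zy tr.
  - exists i => z zy; have zs : nrm (z - y) < s.
      by apply: le_lt_trans (le_trans zy ts) _; rewrite ltr_pdivrMr// ltr_pMr// ltr1n.
    have := hs _ zs; rewrite nrm_distC => h1.
    have h2 := nrmD (B i y - B i z) (B i z); rewrite subrK in h2; lra.
have [f hf] := choice step.
pose p := fix p n := if n is m.+1 then f (m, p m) else (0, 1) : X * R.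
have p0 n : 0 < (p n).2 by elim: n => [|n IH] //=; have [] := hf (n, p n) IH.
have pS n := hf (n, p n) (p0 n).
have pin n k y : nrm (y - (p (n + k)%N).1) <= (p (n + k)%N).2 -> nrm (y - (p n).1) <= (p n).2.
  elim: k y => [|k IH] y; first by rewrite addn0.
  by rewrite addnS => h; apply: IH; have [_ _ h1 _] := pS (n + k)%N; exact: h1.
have pin2 n m : (n <= m)%N -> nrm ((p m).1 - (p n).1) <= (p n).2.
  by move=> /subnKC <-; apply: (pin _ (m - n)%N); rewrite subrr nrm0 ltW.
have [x hx] : exists x : X, (p n).1 @[n --> \oo] --> x.
  apply: cauchyX => e e0.
  have [N hN] : exists N, N.+1%:R^-1 < e.
    by exists (Num.truncn e^-1); rewrite invf_plt ?posrE// truncnS_gt.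
  exists N.+1 => n /pin2 /le_trans; apply.
  by have [_ h _ _] := pS N; apply: le_trans h (ltW hN).
(* The common point x of all the balls violates its own bound K at the stage [(Num.truncn K).+1],
   which is larger than K. *)
have [K hK] := pB x.
have [_ _ _ [i hi]] := pS (Num.truncn K).+1.
have xin n : nrm (x - (p n).1) <= (p n).2.
  by apply: (cvg_nrm_le hx); exists n => // m /= /pin2.
move: hi => /(_ x (xin (Num.truncn K).+2)); apply/negP; rewrite -leNgt.
by apply: le_trans (hK i) (ltW (truncnS_gt _)).
Qed.

End UniformBoundedness.

(** [Q] marks a set that is still rich, [G] a good piece. Each step splits off a good piece and
    keeps a rich remainder disjoint from it, so the pieces are pairwise disjoint. This serves both
    for the boundedness of a vector measure and for separating infinitely many points by disjoint
    open sets. *)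
Lemma exhaustion (T : Type) (Q G : set T -> Prop) (D0 : set T) : Q D0 ->
  (forall D, Q D -> exists V D', [/\ V `<=` D, D' `<=` D, V `&` D' = set0, G V & Q D']) ->
  exists2 V : nat -> set T, trivIset setT V & forall n, G (V n).
Proof.
move=> Q0 step.
have step' D : exists VD : set T * set T, Q D ->
    [/\ VD.1 `<=` D, VD.2 `<=` D, VD.1 `&` VD.2 = set0, G VD.1 & Q VD.2].
  have [/step[V [D' h]]|] := pselect (Q D); first by exists (V, D').
  by exists (D, D).
have [f hf] := choice step'.
pose D n := iter n (fun D => (f D).2) D0.
have QD n : Q (D n) by elim: n => [|n /hf[]].
have sD n k : D (n + k)%N `<=` D n.
  elim: k => [|k IH]; first by rewrite addn0.
  by rewrite addnS; apply: subset_trans IH; have [] := hf _ (QD (n + k)%N).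
exists (fun n => (f (D n)).1); last by move=> n; have [] := hf _ (QD n).
apply: ltn_trivIset => n2 n1 n12; apply/seteqP; split=> // x [h2 h1].
have [_ _ <- _ _] := hf _ (QD n1); split=> //.
apply: (sD n1.+1 (n2 - n1.+1)%N); rewrite subnKC//.
by have [h _ _ _ _] := hf _ (QD n2); apply: h.
Qed.

(** * Finite-dimensional subspaces, total boundedness, Riesz's lemma *)

Section FiniteDimension.
Context {R : realType} {X : completeNormedModType (cplx R)}.
Local Notation C := (cplx R).

Lemma bounded_setP (B : set X) :
  bounded_set B <-> exists K : R, forall x, B x -> nrm x <= K.
Proof.
split=> [[M [Mr h]]|[K h]].
  exists (complex.Re (M + 1)) => x Bx.
  have /h /(_ _ Bx) /= : M < M + 1 by rewrite ltrDl.
  by rewrite nrmE lecE => /andP[].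
exists (ofreal K); split=> [|M KM x /h /= xK]; first by rewrite complex_real.
by rewrite nrmE; apply: le_trans (ltW KM); rewrite ofreal_le.
Qed.

(** The linear span of a list. The recursive form fits inductions that split off one vector z,
    according to whether z already lies in the span of the others. *)
Fixpoint lspan (l : seq X) : set X :=
  if l is x :: l' then [set y | exists a : C, lspan l' (y - a *: x)] else [set 0].

Lemma lspan_lin l (a : C) x y : lspan l x -> lspan l y -> lspan l (a *: x + y).
Proof.
elim: l x y => [|z l IH] x y /=; first by move=> -> ->; rewrite scaler0 addr0.
move=> [b hx] [c hy]; exists (a * b + c).
have -> : a *: x + y - (a * b + c) *: z = a *: (x - b *: z) + (y - c *: z).
  by rewrite scalerDl scalerBr scalerA opprD addrACA.
exact: IH.
Qed.

Lemma lspan0 l : lspan l 0.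
Proof. by elim: l => [|z l IH] //=; exists 0; rewrite scale0r subrr. Qed.

Lemma lspanZ l (a : C) x : lspan l x -> lspan l (a *: x).
Proof. by move=> h; rewrite -[_ *: _]addr0; apply: lspan_lin (lspan0 l). Qed.

Lemma lspanD l x y : lspan l x -> lspan l y -> lspan l (x + y).
Proof. by move=> h; rewrite -[x]scale1r; apply: lspan_lin. Qed.

Lemma lspanB l x y : lspan l x -> lspan l y -> lspan l (x - y).
Proof. by move=> h k; rewrite addrC -scaleN1r; apply: lspan_lin. Qed.

Lemma lspan_cons z l : lspan l `<=` lspan (z :: l).
Proof. by move=> x h /=; exists 0; rewrite scale0r subr0. Qed.

Lemma lspan_mem l x : x \in l -> lspan l x.
Proof.
elim: l => [|z l IH] //; rewrite inE => /predU1P[->|/IH /lspan_cons//].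
by exists 1; rewrite scale1r subrr; exact: lspan0.
Qed.

Lemma lspan_sub l (Y : set X) : Y 0 ->
  (forall (a : C) x y, Y x -> Y y -> Y (a *: x + y)) ->
  (forall x, x \in l -> Y x) -> lspan l `<=` Y.
Proof.
move=> Y0 Ylin; elim: l => [|z l IH] lY x /=; first by move=> ->.
move=> [a /IH h]; rewrite -(subrK (a *: z) x) addrC; apply: Ylin.
  by apply: lY; rewrite mem_head.
by apply: h => w wl; apply: lY; rewrite inE wl orbT.
Qed.

Lemma fin_dim_lspan l : fin_dim (lspan l).
Proof.
exists (size l), (fun i => nth 0 l i); elim: l => [|z l IH] /=.
  apply/seteqP; split => [x ->|x [c _ <-]]; last by rewrite big_ord0.
  by exists (fun _ => 0) => //; rewrite big_ord0.
apply/seteqP; split => x.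
  rewrite {}IH /= => -[a [c _ hc]].
  exists (fun i => if unlift ord0 i is Some j then c j else a) => //.
  rewrite big_ord_recl unlift_none /= -(subrK (a *: z) x) -hc addrC; congr (_ + _).
  by apply: eq_bigr => i _; rewrite liftK.
move=> [c _ <-]; rewrite /= big_ord_recl; exists (c ord0).
rewrite [X in X + _]/= addrAC subrr add0r IH; exists (fun i => c (lift ord0 i)) => //.
Qed.

Lemma fin_dim_sub_lspan (V : set X) : fin_dim V -> exists l, V `<=` lspan l.
Proof.
move=> [n [e ->]]; exists (codom e) => _ [c _ <-].
elim/big_ind: _ => [|x y|i _]; [exact: lspan0|exact: lspanD|].
by apply/lspanZ/lspan_mem/codom_f.
Qed.

Lemma lspan_cons_mem z l : lspan l z -> lspan (z :: l) `<=` lspan l.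
Proof.
move=> lz x [a h]; rewrite -(subrK (a *: z) x); apply: lspanD => //.
exact: lspanZ.
Qed.

Definition approximable (S : set X) (y : X) :=
  forall e : R, 0 < e -> exists2 v, S v & nrm (y - v) < e.

Lemma dist_gt0 (S : set X) y : ~ approximable S y ->
  exists2 d : R, 0 < d & forall v, S v -> d <= nrm (y - v).
Proof.
move=> h; apply: contrapT => k; apply: h => e e0; apply: contrapT => h; apply: k.
exists e => // v Sv; rewrite leNgt; apply/negP => ?.
by apply: h; exists v.
Qed.

(** For a nonzero, x = a (z - v) with v in the span of l. Thus the coefficient of z depends
    boundedly on x once z has positive distance from that span. *)
Lemma lspan_cons_coef z l (d : R) : (forall v, lspan l v -> d <= nrm (z - v)) ->
  forall (a : C) x, lspan l (x - a *: z) -> d * nrm a <= nrm x.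
Proof.
move=> hd a x h; have [->|a0] := eqVneq a 0; first by rewrite nrm0 mulr0 nrm_ge0.
have := hd _ (lspanZ (- a^-1) h).
rewrite scalerBr scalerA mulNr mulVf// scaleN1r opprB addrA subrr sub0r.
rewrite -scaleNr opprK nrmZ => /(ler_wpM2r (nrm_ge0 a)); rewrite mulrAC -nrmM.
by rewrite mulVf// nrm1 mul1r.
Qed.

Lemma invnS_lt (e : R) : 0 < e -> exists N : nat, N.+1%:R^-1 < e.
Proof.
by move=> e0; exists (Num.truncn e^-1); rewrite invf_plt ?posrE// truncnS_gt.
Qed.

Lemma lspan_closed l y : approximable (lspan l) y -> lspan l y.
Proof.
elim: l y => [|z l IH] y hy.
  apply: nrm0_eq0; apply/eqP; rewrite eq_le nrm_ge0 andbT.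
  apply/ler_addgt0Pr => e /hy[_ -> /=].
  by rewrite subr0 add0r => /ltW.
have [lz|/(contra_not (IH z)) /dist_gt0[d d0 hd]] := pselect (lspan l z).
  apply: lspan_cons; apply: IH => e /hy[v lv ve]; exists v => //.
  exact: lspan_cons_mem lz _ lv.
have hv n : exists va : X * C, lspan l (va.1 - va.2 *: z) /\ nrm (y - va.1) < n.+1%:R^-1.
  have [|v [a h] vn] := hy n.+1%:R^-1; first by rewrite invr_gt0 ltr0n.
  by exists (v, a).
have [f hf] := choice hv.
have [a /cvg_nrm ha] : exists a : C, (f n).2 @[n --> \oo] --> a.
  apply: cauchyC => e e0; have [|N hN] := @invnS_lt (e * d / 2).
    by rewrite divr_gt0// mulr_gt0.
  exists N => n Nn; rewrite -(ler_pM2l d0).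
  have [h1 h2] := hf n; have [h3 h4] := hf N.
  apply: (@le_trans _ _ (nrm ((f n).1 - (f N).1))).
    apply: (lspan_cons_coef hd).
    have -> : (f n).1 - (f N).1 - ((f n).2 - (f N).2) *: z =
        (f n).1 - (f n).2 *: z - ((f N).1 - (f N).2 *: z).
      by rewrite scalerBl !opprB addrACA [RHS]addrACA; congr (_ + _); exact: addrC.
    exact: lspanB.
  apply: le_trans (nrm_distD y _ _) _; rewrite [nrm (_ - y)]nrm_distC.
  have : n.+1%:R^-1 <= N.+1%:R^-1 :> R by rewrite lef_pV2 ?posrE ?ltr0n// ler_nat ltnS.
  rewrite mulrC (splitr (e * d)) => h5; apply/ltW/ltrD.
    exact: lt_trans (lt_le_trans h2 h5) hN.
  exact: lt_trans hN.
exists a; apply: IH => e e0.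
have nz1 : 0 < nrm z + 1 by rewrite ltr_wpDl ?nrm_ge0.
have e2 : 0 < e / 2 / (nrm z + 1) by rewrite !divr_gt0.
have [N hN] : exists N : nat, N.+1%:R^-1 < e / 2 by apply: invnS_lt; rewrite divr_gt0.
have [n [/= Nn hn]] := filter_ex (filterI (nbhs_infty_ge N) (ha _ e2)).
have [h1 h2] := hf n; exists ((f n).1 - (f n).2 *: z) => //.
have -> : y - a *: z - ((f n).1 - (f n).2 *: z) = (y - (f n).1) + ((f n).2 - a) *: z.
  by rewrite scalerBl opprB addrACA [RHS]addrACA; congr (_ + _); exact: addrC.
apply: le_lt_trans (nrmD _ _) _; rewrite [ltRHS]splitr nrmZ; apply: ltr_leD.
  apply: lt_trans h2 _; apply: le_lt_trans hN.
  by rewrite lef_pV2 ?posrE ?ltr0n// ler_nat ltnS.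
apply: le_trans (_ : nrm ((f n).2 - a) * (nrm z + 1) <= _).
  by rewrite ler_wpM2l ?nrm_ge0// lerDl.
by rewrite -ler_pdivlMr// ltW.
Qed.

Definition totally_bounded (S : set X) := forall e : R, 0 < e ->
  exists r : seq X, forall x, S x -> exists2 c, c \in r & nrm (x - c) < e.

Lemma interval_net (K d : R) : 0 < d -> exists r : seq R,
  forall a : R, `|a| <= K -> exists2 c, c \in r & `|a - c| <= d.
Proof.
move=> d0; exists [seq d * k%:R - K | k <- iota 0 (Num.truncn ((K + K) / d)).+1] => a.
rewrite ler_norml => /andP[aK Ka].
have a0 : 0 <= (a + K) / d by apply: divr_ge0; [lra|exact: ltW].
have /andP[h1 h2] := truncn_itv a0.
exists (d * (Num.truncn ((a + K) / d))%:R - K).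
  apply/mapP; exists (Num.truncn ((a + K) / d)) => //.
  rewrite mem_iota /= add0n ltnS; apply: le_truncn.
  by rewrite ler_pM2r ?invr_gt0//; lra.
move: h1 h2; rewrite ler_pdivlMr// ltr_pdivrMr// -natr1 => h1 h2.
rewrite ler_norml; apply/andP; split; lra.
Qed.

Lemma disc_net (K d : R) : 0 < d -> exists r : seq C,
  forall a : C, nrm a <= K -> exists2 c, c \in r & nrm (a - c) <= d.
Proof.
move=> d0; have [|r hr] := @interval_net K (d / 2); first by rewrite divr_gt0.
exists [seq (x +i* y)%C | x <- r, y <- r] => -[x y] hK.
have [b bx hb] := hr x (le_trans (Re_le_nrm (x +i* y)%C) hK).
have [c cx hc] := hr y (le_trans (Im_le_nrm (x +i* y)%C) hK).
exists (b +i* c)%C; first by apply: allpairs_f.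
apply: le_trans (nrm_le_ReIm _) _; rewrite [leRHS]splitr; exact: lerD.
Qed.

Lemma totally_bounded_subset (S S' : set X) : S `<=` S' ->
  totally_bounded S' -> totally_bounded S.
Proof. by move=> SS h e /h[r hr]; exists r => x /SS /hr. Qed.

Lemma totally_bounded_add (S S' : set X) : totally_bounded S -> totally_bounded S' ->
  totally_bounded [set x | exists y z, [/\ S y, S' z & x = y + z]].
Proof.
move=> h h' e e0; have e2 : 0 < e / 2 by rewrite divr_gt0.
have [r hr] := h _ e2; have [s hs] := h' _ e2.
exists [seq x + y | x <- r, y <- s] => _ [y [z [/hr[c cr hc] /hs[d ds hd] ->]]].
exists (c + d); first by apply: allpairs_f.
by rewrite opprD addrACA [ltRHS]splitr; apply: le_lt_trans (nrmD _ _) (ltrD hc hd).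
Qed.

(** This is the form in which a uniform limit of finite-rank operators is seen to be compact. *)
Lemma totally_bounded_approx (S : set X) :
  (forall e : R, 0 < e -> exists2 S', totally_bounded S' & forall x, S x ->
     exists2 y, S' y & nrm (x - y) <= e) -> totally_bounded S.
Proof.
move=> h e e0; have e2 : 0 < e / 2 by rewrite divr_gt0.
have [S' /(_ _ e2)[r hr] hS] := h _ e2.
exists r => x /hS[y /hr[c cr yc] xy]; exists c => //.
apply: le_lt_trans (nrm_distD y _ _) _; rewrite [ltRHS]splitr; exact: ler_ltD.
Qed.

(** Induction on the list: when z is at distance at least d > 0 from the span of l, the
    z-coefficient stays in a disc of radius K / d and the remainder in a ball of radius K + (K / d)
    |z|, so a net for the sum can be built from nets for the two parts. *)
Lemma totally_bounded_lspan l (K : R) :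
  totally_bounded [set v | lspan l v /\ nrm v <= K].
Proof.
elim: l K => [|z l IH] K.
  by move=> e e0; exists [:: 0] => x [-> _]; exists 0; rewrite ?mem_head// subrr nrm0.
have [lz|/(contra_not (@lspan_closed l z)) /dist_gt0[d d0 hd]] := pselect (lspan l z).
  apply: totally_bounded_subset (IH K) => x [lx xK]; split=> //.
  exact: lspan_cons_mem lz _ lx.
apply: totally_bounded_subset (totally_bounded_add (IH (K + K / d * nrm z))
  (_ : totally_bounded [set a *: z | a in [set a : C | nrm a <= K / d]])).
  move=> x [[a la] xK]; have aK : nrm a <= K / d.
    by rewrite ler_pdivlMr// mulrC; apply: le_trans xK; exact: (lspan_cons_coef hd).
  exists (x - a *: z), (a *: z); split; [|by exists a|by rewrite subrK].
  split=> //; apply: le_trans (nrmB _ _) (lerD xK _).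
  by rewrite nrmZ ler_wpM2r// nrm_ge0.
move=> e e0; have nz1 : 0 < nrm z + 1 by rewrite ltr_wpDl ?nrm_ge0.
have [|r hr] := @disc_net (K / d) (e / (nrm z + 1)); first by rewrite divr_gt0.
exists [seq c *: z | c <- r] => _ [a /hr[c cr ac] <-].
exists (c *: z); first exact: map_f.
rewrite -scalerBl nrmZ; apply: (@le_lt_trans _ _ (e / (nrm z + 1) * nrm z)).
  by rewrite ler_wpM2r ?nrm_ge0.
by rewrite mulrAC ltr_pdivrMr// ltr_pM2l// ltrDl.
Qed.

(** An ultrafilter containing the closure of S contains one ball of each finite cover, hence is
    Cauchy and converges by completeness. *)
Lemma totally_bounded_precompact (S : set X) : totally_bounded S -> precompact S.
Proof.
move=> tS; rewrite precompactE compact_ultra => F FU FS.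
suff /cauchy_cvg /cvg_ex[p hp] : cauchy F.
  exists p; split=> //; apply: closed_closure => B /hp FB.
  exact: filter_ex (filterI FS FB).
apply: cauchy_exP => e e0; have ee := ge0_ofreal (ltW e0).
have e1 : 0 < complex.Re e / 2 by rewrite divr_gt0// -ofreal_lt -ee.
have [r hr] := tS _ e1.
have : F [set x | exists2 c, c \in r & nrm (x - c) < complex.Re e].
  apply: filterS FS => x Sx.
  have xB : nbhs x [set y | nrm (y - x) < complex.Re e / 2].
    by apply/nbhs_nrm; exists (complex.Re e / 2).
  have [y [Sy xy]] := Sx _ xB.
  have [c cr yc] := hr _ Sy; exists c => //.
  by apply: le_lt_trans (nrm_distD y _ _) _; rewrite [ltRHS]splitr nrm_distC ltrD.
elim: r {hr} => [|c r IH] Fr.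
  by have [x [c]] := filter_ex Fr.
have [Fc|Fc] := in_ultra_setVsetC [set x | nrm (x - c) < complex.Re e] FU.
  exists c; apply: filterS Fc => x.
  by rewrite -ball_normE /= nrmE ee ofreal_lt nrm_distC.
apply: IH; apply: filterS2 Fr Fc => x [d]; rewrite inE => /predU1P[->//|dr xd] _.
by exists d.
Qed.

(** Two terms of the sequence are taken near a cluster point. Compactness enters the necessity part
    only in this form: the image of a bounded set contains no uniformly separated sequence. *)
Lemma precompact_close (S : set X) (u : nat -> X) (e : R) : precompact S ->
  (forall n, S (u n)) -> 0 < e -> exists m n, (m < n)%N /\ nrm (u m - u n) < e.
Proof.
rewrite precompactE => cS Su e0.
have [|p [_ hp]] := cS (u @ \oo) (fmap_proper_filter u eventually_filter) _.
  by exists 0%N => // n _; exact: subset_closure.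
have e2 : 0 < e / 2 by rewrite divr_gt0.
have pB : nbhs p [set y | nrm (y - p) < e / 2] by apply/nbhs_nrm; exists (e / 2).
have F k : (u n @[n --> \oo]) [set u n | n in [set n | (k <= n)%N]].
  by exists k => // n /= kn; exists n.
have [_ [[m _ <-] hm]] := hp _ _ (F 0%N) pB.
have [_ [[n mn <-] hn]] := hp _ _ (F m.+1) pB.
exists m, n; split => //; apply: le_lt_trans (nrm_distD p _ _) _.
by rewrite [ltRHS]splitr ltrD// nrm_distC.
Qed.

(** The vector g is f - v normalised, where v in the span is closer to f than twice the distance
    from f to the span; that distance is positive because the span is closed. *)
Lemma riesz_lemma (Y : set X) (l : seq X) f : Y 0 ->
  (forall (a : C) x y, Y x -> Y y -> Y (a *: x + y)) ->
  (forall x, x \in l -> Y x) -> Y f -> ~ lspan l f ->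
  exists g, [/\ Y g, nrm g = 1 & forall v, lspan l v -> 1 / 2 <= nrm (g - v)].
Proof.
move=> Y0 Ylin lY Yf /(contra_not (@lspan_closed l f)) /dist_gt0[d d0 hd].
pose D := [set nrm (f - v) | v in lspan l].
have D0 : D !=set0 by exists (nrm (f - 0)), 0 => //; exact: lspan0.
have dD : lbound D d by move=> _ [v lv <-]; exact: hd.
have Dinf : has_inf D by split=> //; exists d.
have i0 : 0 < inf D by apply: lt_le_trans d0 _; exact: lb_le_inf.
have [_ [v lv <-] hv] := inf_adherent i0 Dinf.
have fv0 : 0 < nrm (f - v) by apply: lt_le_trans (hd _ lv).
have Yv : Y v by apply: (lspan_sub Y0 Ylin lY).
pose b : C := ofreal (nrm (f - v))^-1.
have nb : nrm b = (nrm (f - v))^-1 by rewrite nrm_ofreal gtr0_norm// invr_gt0.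
exists (b *: (f - v)); split.
- rewrite -[b *: _]addr0; apply: (Ylin) => //.
  by rewrite addrC -scaleN1r; apply: Ylin.
- by rewrite nrmZ nb mulVf// gt_eqF.
- move=> w lw; pose b' : C := ofreal (nrm (f - v)).
  have bb : b * b' = 1 by rewrite -ofrealM mulVf// gt_eqF.
  have -> : b *: (f - v) - w = b *: (f - (v + b' *: w)).
    by rewrite opprD addrA [RHS]scalerBr scalerA bb scale1r.
  rewrite nrmZ nb [leRHS]mulrC ler_pdivlMr//.
  have h : inf D <= nrm (f - (v + b' *: w)).
    apply: ge_inf; first by exists d.
    by exists (v + b' *: w) => //; apply: lspanD => //; exact: lspanZ.
  lra.
Qed.

(** If Y were not finite-dimensional, iterating Riesz's lemma would give unit vectors in Y at mutual
    distance at least 1/2. Since T is bounded below on Y, their images would be separated, against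
    compactness. *)
Lemma fin_dim_compact (Y : set X) (T : {linear X -> X}) (K : R) : Y 0 ->
  (forall (a : C) x y, Y x -> Y y -> Y (a *: x + y)) -> compact_op T ->
  (forall f, Y f -> nrm f <= K * nrm (T f)) -> fin_dim Y.
Proof.
move=> Y0 Ylin cT hK; apply: contrapT => nfin.
have step (l : seq X) : exists g, (forall x, x \in l -> Y x) ->
    [/\ Y g, nrm g = 1 & forall v, lspan l v -> 1 / 2 <= nrm (g - v)].
  have [lY|] := pselect (forall x, x \in l -> Y x); last by exists 0.
  have [f Yf lf] : exists2 f, Y f & ~ lspan l f.
    apply: contrapT => h; apply: nfin.
    have -> : Y = lspan l; last exact: fin_dim_lspan.
    apply/seteqP; split=> [f Yf|]; last exact: lspan_sub.
    by apply: contrapT => lf; apply: h; exists f.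
  by have [g hg] := riesz_lemma Y0 Ylin lY Yf lf; exists g.
have [g hg] := choice step.
(* [l n] lists the first n vectors; the next one, [g (l n)], has distance at least 1/2 from their
   span. *)
pose l := fix l n := if n is m.+1 then g (l m) :: l m else [::].
have lY n x : x \in l n -> Y x.
  elim: n x => [|n IH] x //=; rewrite inE => /predU1P[->|/IH//].
  by have [] := hg _ IH.
have gl m n : (m < n)%N -> g (l m) \in l n.
  elim: n => [|n IH] //; rewrite ltnS leq_eqVlt => /predU1P[->|/IH h] /=.
    exact: mem_head.
  by rewrite inE h orbT.
have K0 : 0 < `|K| + 1 by rewrite ltr_wpDl.
have [] := @precompact_close _ (fun n => T (g (l n))) (1 / 2 / (`|K| + 1))
  (cT [set f | nrm f <= 1] _).
- by apply/bounded_setP; exists 1.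
- by move=> n; exists (g (l n)) => //=; have [_ -> _] := hg _ (lY n).
- by rewrite !divr_gt0.
move=> m [n [mn]]; rewrite nrm_distC -linearB ltr_pdivlMr// => h.
have [Ym _ _] := hg _ (lY m); have [Yn _ hn] := hg _ (lY n).
have := hn _ (lspan_mem (gl _ _ mn)); apply/negP; rewrite -ltNge.
apply: le_lt_trans (hK _ _) _; first by rewrite addrC -scaleN1r; exact: Ylin.
apply: le_lt_trans h; rewrite mulrC ler_wpM2l ?nrm_ge0//.
by rewrite ler_wpDr// ler_norm.
Qed.

End FiniteDimension.

(** * Linear combinations controlled by their partial sums *)

Section Combinations.
Context {R : realType} {V : normedModType (cplx R)}.
Local Notation C := (cplx R).

(* A convex function on the cube [0, 1]^r is bounded by its values at the
   vertices, which are the partial sums. *)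
Lemma convex_comb_bound (I : eqType) (r : seq I) (t : I -> R) (x : I -> V)
    (K : R) (y : V) : uniq r -> (forall i, i \in r -> 0 <= t i <= 1) ->
  (forall P : pred I, nrm (y + \sum_(i <- r | P i) x i) <= K) ->
  nrm (y + \sum_(i <- r) ofreal (t i) *: x i) <= K.
Proof.
elim: r y => [|i r IH] y /=; first by move=> _ _ /(_ predT); rewrite !big_nil.
move=> /andP[ir ur] ht hK; rewrite big_cons.
have /andP[t0 t1] := ht i (mem_head _ _).
have ht' j : j \in r -> 0 <= t j <= 1 by move=> jr; apply: ht; rewrite inE jr orbT.
have h1 := IH y ur ht'; have h2 := IH (y + x i) ur ht'.
set s := \sum_(j <- r) _ in h1 h2 *.
have -> : y + (ofreal (t i) *: x i + s) =
    ofreal (1 - t i) *: (y + s) + ofreal (t i) *: (y + x i + s).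
  rewrite /ofreal rmorphB rmorph1 scalerBl scale1r [y + x i + s]addrAC.
  by rewrite [X in _ = _ + X]scalerDr [RHS]addrA subrK addrCA addrC.
apply: le_trans (nrmD _ _) _; rewrite !nrmZ !nrm_ofreal !ger0_norm ?subr_ge0//.
have {}h1 : nrm (y + s) <= K.
  apply: h1 => P; have := hK (fun j => (j != i) && P j).
  rewrite big_cons eqxx /=; congr (nrm (_ + _) <= _).
  rewrite big_seq_cond [RHS]big_seq_cond; apply: eq_bigl => j.
  by case: (eqVneq j i) => [->|]; rewrite ?(negbTE ir).
have {}h2 : nrm (y + x i + s) <= K.
  apply: h2 => P; have := hK (fun j => (j == i) || P j).
  rewrite big_cons eqxx /= addrA; congr (nrm (_ + _) <= _).
  rewrite big_seq_cond [RHS]big_seq_cond; apply: eq_bigl => j.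
  by case: (eqVneq j i) => [->|]; rewrite ?(negbTE ir).
nra.
Qed.

(** Split each coefficient into the positive and negative parts of its real and imaginary parts.
    Divided by L these lie in [0, 1], so each of the four sums is bounded by K. *)
Lemma comb_bound (I : eqType) (r : seq I) (a : I -> C) (x : I -> V) (K L : R) :
  uniq r -> 0 < L -> (forall i, i \in r -> nrm (a i) <= L) ->
  (forall P : pred I, nrm (\sum_(i <- r | P i) x i) <= K) ->
  nrm (\sum_(i <- r) a i *: x i) <= 4 * L * K.
Proof.
move=> ur L0 ha hK.
have real (t : I -> R) : (forall i, i \in r -> 0 <= t i <= 1) ->
    nrm (\sum_(i <- r) ofreal (t i) *: x i) <= K.
  move=> ht; rewrite -[X in nrm X]add0r; apply: convex_comb_bound => // P.
  by rewrite add0r.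
pose pos (b : R) := Num.max b 0 / L.
have hpos (b : R) : `|b| <= L -> 0 <= pos b <= 1.
  move=> bL; apply/andP; split; first by rewrite divr_ge0 ?(ltW L0)// le_max lexx orbT.
  by rewrite ler_pdivrMr// mul1r ge_max (ltW L0) andbT; apply: le_trans (ler_norm _) bL.
have hRe i : i \in r -> `|complex.Re (a i)| <= L.
  by move=> /ha; apply: le_trans; exact: Re_le_nrm.
have hIm i : i \in r -> `|complex.Im (a i)| <= L.
  by move=> /ha; apply: le_trans; exact: Im_le_nrm.
pose s1 := \sum_(i <- r) ofreal (pos (complex.Re (a i))) *: x i.
pose s2 := \sum_(i <- r) ofreal (pos (- complex.Re (a i))) *: x i.
pose s3 := \sum_(i <- r) ofreal (pos (complex.Im (a i))) *: x i.
pose s4 := \sum_(i <- r) ofreal (pos (- complex.Im (a i))) *: x i.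
pose im : C := 'i%C.
have -> : \sum_(i <- r) a i *: x i = ofreal L *: (s1 - s2 + im *: (s3 - s4)).
  rewrite /s1 /s2 /s3 /s4 -!sumrB [im *: _]scaler_sumr -big_split scaler_sumr /=.
  apply: eq_bigr => i _; rewrite -!scalerBl scalerA -scalerDl scalerA.
  congr (_ *: _).
  have E b : b = L * (pos b - pos (- b)).
    rewrite /pos -mulrBl mulrCA divff ?gt_eqF// mulr1.
    by case: (ltP b 0); case: (ltP (- b) 0); lra.
  case: (a i) => p q /=; rewrite {1}(E p) {1}(E q) /im /ofreal.
  by apply/eqP; rewrite eq_complex /=; apply/andP; split; apply/eqP; ring.
have n1 : nrm im = 1 by rewrite /nrm normc_def /= expr0n expr1n add0r sqrtr1.
have h1 : nrm s1 <= K by apply: real => i /hRe /hpos.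
have h2 : nrm s2 <= K by apply: real => i /hRe; rewrite -normrN => /hpos.
have h3 : nrm s3 <= K by apply: real => i /hIm /hpos.
have h4 : nrm s4 <= K by apply: real => i /hIm; rewrite -normrN => /hpos.
have k1 := nrmD (s1 - s2) (im *: (s3 - s4)).
have k2 := nrmB s1 s2; have k3 := nrmB s3 s4.
have k4 := nrmZ im (s3 - s4); rewrite n1 mul1r in k4.
have h : nrm (s1 - s2 + im *: (s3 - s4)) <= 4 * K by lra.
rewrite nrmZ nrm_ofreal gtr0_norm//.
by apply: le_trans (ler_wpM2l (ltW L0) h) _; rewrite mulrCA mulrA.
Qed.

End Combinations.

(** * Additivity and uniform boundedness of a spectral measure *)

Section SpectralMeasure.
Context {R : realType} {X : completeNormedModType (cplx R)}.
Local Notation C := (cplx R).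
Local Notation meas := (@measurable _ (borelC R)).

Lemma open_nrm (A : set C) :
  (forall x, A x -> exists2 e : R, 0 < e & forall y, nrm (y - x) < e -> A y) -> open A.
Proof. by move=> h; rewrite openE => x /h /nbhs_nrm. Qed.

Lemma open_meas (U : set C) : open U -> meas U.
Proof. by move=> oU; apply: sub_sigma_algebra. Qed.

Lemma closed_meas (U : set C) : closed U -> meas U.
Proof.
by move=> /closed_openC /open_meas /measurableC; rewrite setCK.
Qed.

Lemma set1_meas (z : C) : meas [set z].
Proof.
apply: closed_meas; rewrite -[X in closed X]setCK; apply: open_closedC.
apply: open_nrm => x /= /eqP xz; exists (nrm (z - x)).
  by rewrite nrm_gt0// subr_eq0 eq_sym.
by move=> y yx yz; move: yx; rewrite yz ltxx.
Qed.

Variables (E : set C -> {linear X -> X}) (sE : spectral_measure E).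

Lemma E_continuous D : meas D -> continuous (E D).
Proof. by case: sE => h _ _ _ /h[]. Qed.

Lemma E_setT f : E setT f = f.
Proof. by case: sE => _ [_ ->]. Qed.

Lemma E_set0 f : E set0 f = 0.
Proof. by case: sE => _ [-> _]. Qed.

Lemma E_setI D D' f : meas D -> meas D' -> E (D `&` D') f = E D (E D' f).
Proof. by case: sE => _ _ h _ mD mD'; exact: h. Qed.

Lemma E_bigcup (D : nat -> set C) f : (forall n, meas (D n)) -> trivIset setT D ->
  \sum_(0 <= i < n) E (D i) f @[n --> \oo] --> E (\bigcup_n D n) f.
Proof. by case: sE => _ _ _ h mD tD; exact: h. Qed.

Lemma E_setU D D' f : meas D -> meas D' -> D `&` D' = set0 ->
  E (D `|` D') f = E D f + E D' f.
Proof.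
move=> mD mD' DD; have := @E_bigcup (bigcup2 D D') f.
rewrite bigcup2E => h; apply: (cvg_nrm_unique (h _ _)).
- by move=> [|[|n]] //; exact: measurable0.
- by rewrite -trivIset_bigcup2.
- apply/cvg_nrm => e e0; exists 2%N => // n /= n2.
  rewrite (big_cat_nat (n := 2))//= big_ltn// big_nat1 /= big1_seq.
    by rewrite addr0 subrr nrm0.
  move=> i /andP[_]; rewrite mem_index_iota => /andP[i2 _].
  by case: i i2 => [|[|i]] //= _; rewrite /bigcup2 /= E_set0.
Qed.

Lemma E_setIC D U f : meas D -> meas U -> E D f = E (D `&` U) f + E (D `\` U) f.
Proof.
move=> mD mU; rewrite -E_setU; first by rewrite setUIDK.
- exact: (@measurableI _ (borelC R)).
- exact: (@measurableD _ (borelC R)).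
- by rewrite setDE setIACA setICr setI0.
Qed.

Lemma E_idem D f : meas D -> E D (E D f) = E D f.
Proof. by case: sE => h _ _ _ /h[]. Qed.

Lemma E_sub0 D D' f : meas D -> meas D' -> D' `<=` D -> E D f = 0 -> E D' f = 0.
Proof. by move=> mD mD' /setIidl <- h; rewrite E_setI// h linear0. Qed.

Lemma E_bigcup0 (D : nat -> set C) f : (forall n, meas (D n)) ->
  (forall n, E (D n) f = 0) -> E (\bigcup_n D n) f = 0.
Proof.
move=> mD D0; have mS := seqDU_measurable mD.
rewrite seqDU_bigcup_eq.
have h := @E_bigcup (seqDU D) f mS (trivIset_seqDU _).
apply: (cvg_nrm_unique h).
apply/cvg_nrm => e e0; apply: nearW => n; rewrite big1 ?subrr ?nrm0// => i _.
by apply: (@E_sub0 (D i)) => //; exact: subset_seqDU.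
Qed.

Lemma E_family (I : eqType) (r : seq I) (D : I -> set C) f :
  uniq r -> (forall i, i \in r -> meas (D i)) ->
  (forall i j, i \in r -> j \in r -> i != j -> D i `&` D j = set0) ->
  meas [set x | exists2 i, i \in r & D i x] /\
  \sum_(i <- r) E (D i) f = E [set x | exists2 i, i \in r & D i x] f.
Proof.
elim: r => [|i r IH] /=.
  move=> _ _ _; have -> : [set x | exists2 i, i \in [::] & D i x] = set0.
    by apply/seteqP; split=> x // [].
  by rewrite big_nil E_set0.
move=> /andP[ir ur] mD dD.
have -> : [set x | exists2 j, j \in i :: r & D j x] =
    D i `|` [set x | exists2 j, j \in r & D j x].
  apply/seteqP; split=> x.
    by move=> [j]; rewrite inE => /predU1P[->|jr] Dx; [left|right; exists j].
  move=> [Dx|[j jr Dx]]; first by exists i; rewrite ?mem_head.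
  by exists j; rewrite ?inE ?jr ?orbT.
have mi := mD i (mem_head _ _).
have [||mr hr] := IH ur.
- by move=> j jr; apply: mD; rewrite inE jr orbT.
- by move=> j k jr kr; apply: dD; rewrite inE ?jr ?kr orbT.
split; first exact: (@measurableU _ (borelC R)).
rewrite big_cons hr E_setU//; apply/seteqP; split=> x // [Dx [j jr Djx]].
have ij : i != j by apply: contraNneq ir => ->.
by rewrite -(dD i j (mem_head _ _) _ ij) ?inE ?jr ?orbT.
Qed.

(** By uniform boundedness it is enough to bound [E D f] over Borel sets D for each fixed f. If this
    fails, there are disjoint sets whose values at f have norm at least 1, and the corresponding
    series cannot converge. *)
Lemma E_bounded : exists2 M, 1 <= M & forall D f, meas D -> nrm (E D f) <= M * nrm f.
Proof.
have [||M M0 hM] := @uniform_boundedness _ _ {D : set C | meas D} (fun D => E (sval D)).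
- by move=> [D mD]; exact: E_continuous.
- move=> f; apply: contrapT => hf.
  pose Q D := meas D /\
    forall K, exists B, [/\ B `<=` D, meas B & K < nrm (E B f)].
  pose G D := meas D /\ 1 <= nrm (E D f).
  have Q0 : Q setT.
    split=> [|K]; first exact: measurableT.
    apply: contrapT => h; apply: hf; exists K => -[B mB] /=.
    by rewrite leNgt; apply/negP => ?; apply: h; exists B.
  have [D [mD hD]|V tV GV] := exhaustion (G := G) Q0.
    (* With |E(B)f| > |E(D)f| + 1, both B and its complement in D have values of norm at least 1.
       Unboundedness on subsets of D passes to one of the two; the other is split off as the good
       piece. *)
    have [B [BD mB hB]] := hD (nrm (E D f) + 1).
    have mDB := measurableD mD mB.
    have EDB := E_setIC f mD mB; rewrite (setIidr BD) in EDB.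
    have GB : G B by split => //; have := nrm_ge0 (E D f); lra.
    have GDB : G (D `\` B).
      split => //; have := nrmB (E D f) (E (D `\` B) f).
      rewrite {1}EDB addrK; lra.
    have [QB|nQB] := pselect (Q B).
      exists (D `\` B), B; split=> //; exact: setDKI.
    exists B, (D `\` B); split=> //; first exact: setDIK.
    have [K hK] : exists K, forall B', B' `<=` B -> meas B' -> nrm (E B' f) <= K.
      apply: contrapT => h; apply: nQB; split=> // K; apply: contrapT => k; apply: h.
      by exists K => B' BB mB'; rewrite leNgt; apply/negP => ?; apply: k; exists B'.
    split=> // L; have [B' [B'D mB' hB']] := hD (L + K).
    (* The part of B' inside B contributes at most K, so the excess over L survives on the part
       outside B. *)
    exists (B' `\` B); split; [exact: setSD|exact: (@measurableD _ (borelC R))|].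
    have := hK (B' `&` B) (@subIsetr _ _ _) (measurableI _ _ mB' mB).
    move: hB'; rewrite (E_setIC f mB' mB).
    have := nrmD (E (B' `&` B) f) (E (B' `\` B) f); lra.
  have /cvg_series_cvg_0 : cvgn (series (fun n => E (V n) f)).
    apply/cvg_ex; exists (E (\bigcup_n V n) f).
    by apply: E_bigcup => // n; have [] := GV n.
  move=> /cvg_nrm /(_ 1 ltr01)[N _ /(_ N (leqnn _))] /=.
  by rewrite subr0 ltNge; have [_ ->] := GV N.
- exists (M + 1) => [|D f mD]; first by rewrite lerDr.
  apply: le_trans (hM (exist _ D mD) f) _.
  by rewrite ler_wpM2r ?nrm_ge0// lerDl.
Qed.

(** Any partial sum of the [E (D i) f] is the value of E at a disjoint union, hence bounded by M
    |f|, and [comb_bound] applies. *)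
Lemma E_comb_bound (M : R) (I : eqType) (r : seq I) (D : I -> set C) (a : I -> C)
    (L : R) f :
  (forall D f, meas D -> nrm (E D f) <= M * nrm f) ->
  uniq r -> (forall i, i \in r -> meas (D i)) ->
  (forall i j, i \in r -> j \in r -> i != j -> D i `&` D j = set0) ->
  0 < L -> (forall i, i \in r -> nrm (a i) <= L) ->
  nrm (\sum_(i <- r) a i *: E (D i) f) <= 4 * L * (M * nrm f).
Proof.
move=> hM ur mD dD L0 ha; apply: comb_bound => // P; rewrite -big_filter.
have [|||mS ->] := @E_family _ [seq i <- r | P i] D f; last exact: hM.
- exact: filter_uniq.
- by move=> i; rewrite mem_filter => /andP[_]; exact: mD.
- by move=> i j; rewrite !mem_filter => /andP[_ ir] /andP[_ jr]; exact: dD.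
Qed.

End SpectralMeasure.

(** * The operator and its spectral measure near a point of the spectrum *)

Section SpectralOperator.
Context {R : realType} {X : completeNormedModType (cplx R)}.
Local Notation C := (cplx R).
Local Notation meas := (@measurable _ (borelC R)).

Variables (E : set C -> {linear X -> X}) (sE : spectral_measure E).

(** Open squares with rational centres form a base of the topology. Their index type is countable,
    so [pickle] enumerates them. *)
Definition box (p : rat * rat * nat) : set C :=
  [set z | `|complex.Re z - ratr p.1.1| < p.2.+1%:R^-1 /\
           `|complex.Im z - ratr p.1.2| < p.2.+1%:R^-1].

Lemma open_box p : open (box p).
Proof.
apply: open_nrm => z [h1 h2].
exists (Num.min (p.2.+1%:R^-1 - `|complex.Re z - ratr p.1.1|)
         (p.2.+1%:R^-1 - `|complex.Im z - ratr p.1.2|)).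
  by rewrite lt_min !subr_gt0 h1.
move=> y; rewrite lt_min => /andP[k1 k2].
have := le_lt_trans (Re_le_nrm _) k1; have := le_lt_trans (Im_le_nrm _) k2.
case: y z {k1 k2} h1 h2 => [a b] [c d] /= h1 h2 k1 k2.
have e1 := ler_normD (a - c) (c - ratr p.1.1).
have e2 := ler_normD (b - d) (d - ratr p.1.2).
rewrite !addrA !subrK in e1 e2.
by split; [apply: le_lt_trans e1 _|apply: le_lt_trans e2 _]; rewrite -ltrBrDr.
Qed.

Lemma box_base (z : C) (e : R) : 0 < e ->
  exists p, box p z /\ forall y, box p y -> nrm (y - z) < e.
Proof.
move=> e0; have [|N hN] := @invnS_lt _ (e / 4); first by rewrite divr_gt0.
have n0 : 0 < N.+1%:R^-1 :> R by rewrite invr_gt0 ltr0n.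
have rx (x : R) : exists a : rat, `|x - ratr a| < N.+1%:R^-1.
  have [|a] := @rat_in_itvoo R (x - N.+1%:R^-1) (x + N.+1%:R^-1).
    by rewrite ltrBlDr -addrA ltrDl addr_gt0.
  rewrite in_itv /= => /andP[h1 h2].
  by exists a; rewrite distrC ltr_distl h1.
have [a ha] := rx (complex.Re z); have [b hb] := rx (complex.Im z).
exists (a, b, N); split=> // y [/= h1 h2].
apply: le_lt_trans (nrm_le_ReIm _) _.
case: y z ha hb h1 h2 => [u v] [c d] /= ha hb h1 h2.
have e1 := ler_normB (u - ratr a) (c - ratr a).
have e2 := ler_normB (v - ratr b) (d - ratr b).
rewrite !opprB !addrA !subrK in e1 e2.
by move: N.+1%:R^-1 hN ha hb h1 h2 {n0} => q; lra.
Qed.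

Lemma suppC_open_null z : ~ spectral_support E z ->
  exists U, [/\ open U, U z & forall g, E U g = 0].
Proof.
move=> h; apply: contrapT => k; apply: h => U oU Uz; apply: contrapT => l; apply: k.
by exists U; split=> // g; apply: contrapT => m; apply: l; exists g.
Qed.

Lemma supp_closed : closed (spectral_support E).
Proof.
rewrite -[X in closed X]setCK; apply: open_closedC; rewrite openE => z.
move=> /suppC_open_null[U [oU Uz U0]]; apply: (@filterS _ _ _ U).
  by move=> y Uy /(_ U oU Uy)[g]; apply; exact: U0.
exact: open_nbhs_nbhs.
Qed.

(** Every point outside the support has a null neighbourhood, hence lies in a box of the countable
    base whose projection kills f. The union of all such boxes is null for f and covers the
    complement. *)
Lemma E_suppC f : E (~` spectral_support E) f = 0.
Proof.
pose D n := if unpickle n is Some p then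
   (if pselect (E (box p) f = 0) then box p else set0) else set0.
have mD n : meas (D n).
  rewrite /D; case: unpickle => [p|]; last exact: measurable0.
  by case: pselect => ?; [exact: open_meas (@open_box p)|exact: measurable0].
have D0 n : E (D n) f = 0.
  rewrite /D; case: unpickle => [p|]; last exact: E_set0.
  by case: pselect => // ?; exact: E_set0.
have mS := measurableC (closed_meas supp_closed).
have mDD : meas (\bigcup_n D n) by apply: (@bigcup_measurable _ (borelC R)).
apply: (E_sub0 sE mDD mS); last exact: E_bigcup0.
move=> z /suppC_open_null[U [oU Uz U0]].
have /nbhs_nrm[e e0 he] : nbhs z U by exact: open_nbhs_nbhs.
have [p [pz hp]] := box_base z e0.
have p0 : E (box p) f = 0.
  apply: (E_sub0 sE (open_meas oU) (open_meas (@open_box p))) => // y /hp; exact: he.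
have Dp : D (pickle p) = box p by rewrite /D pickleK; case: pselect.
by exists (pickle p); [exact: I|rewrite Dp].
Qed.

Lemma E_suppI D f : meas D -> E (D `&` spectral_support E) f = E D f.
Proof.
move=> mD; have mS := closed_meas supp_closed.
rewrite [RHS](E_setIC sE f mD mS) [X in _ + X](E_sub0 sE (measurableC mS) _ _ (E_suppC f)).
- by rewrite addr0.
- exact: (@measurableD _ (borelC R)).
- by move=> x [].
Qed.

Variables (M : R) (M1 : 1 <= M).
Hypothesis hM : forall D f, meas D -> nrm (E D f) <= M * nrm f.

Variable A : operator X.
Let S := spectral_support E.
Hypothesis hG : forall f y, op_graph A (f, y) <-> is_spectral_integral E S id f y.

Lemma E_cvg U (T : Type) (F : set_system T) (FF : Filter F) (u : T -> X) y : meas U ->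
  u x @[x --> F] --> y -> E U (u x) @[x --> F] --> E U y.
Proof. by move=> mU; apply: linear_cvg; exact: (E_continuous sE mU). Qed.

Lemma simple_integralE s f : simple_function s -> simple_integral E s f =
  \sum_(z <- finmap.enum_fset (fset_set (range s))) z *: E (s @^-1` [set z]) f.
Proof. by move=> [fs _]; rewrite /simple_integral fsbig_finite. Qed.

Lemma simple_fiber_meas s (z : C) : simple_function s -> meas (s @^-1` [set z]).
Proof.
move=> [_ ms]; rewrite -[X in meas X]setTI.
exact: (ms measurableT [set z] (set1_meas z)).
Qed.

(** The projection E(U) commutes with integrals of simple functions and, being continuous, with both
    limits that define A. *)
Lemma graph_E U f y : meas U -> op_graph A (f, y) -> op_graph A (E U f, E U y).
Proof.
move=> mU /hG[u [hu uy]]; apply/hG; exists (fun n => E U (u n)); split.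
  move=> n; have [s [ss sF su]] := hu n; exists s; split=> //.
  suff -> : (fun k => simple_integral E (s k) (E U f)) =
      (fun k => E U (simple_integral E (s k) f)).
    exact: (E_cvg _ mU su).
  apply/funext => k; rewrite !simple_integralE// linear_sum; apply: eq_bigr => z _.
  have mz := simple_fiber_meas z (ss k).
  by rewrite linearZ /= -!E_setI// setIC.
exact: (E_cvg _ mU uy).
Qed.

(** On U the integrand z - l is bounded by e, so its integral has norm at most 4 e M |f|. This is
    proved for simple functions within d of the truncated identity, which gives e + d, and then d
    tends to 0. *)
Lemma graph_bound U f y (l : C) (e : R) : meas U -> U `<=` S -> 0 <= e ->
  (forall z, U z -> nrm (z - l) <= e) -> op_graph A (f, y) ->
  nrm (E U y - l *: E U f) <= 4 * e * (M * nrm f).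
Proof.
move=> mU US e0 hU /hG[u [hu uy]].
have key (d : R) : 0 < d -> nrm (E U y - l *: E U f) <= 4 * (e + d) * (M * nrm f).
  move=> d0; apply: (cvg_nrm_le (E_cvg _ mU uy)).
  (* From this index on, U lies in the disc of radius n, so the truncated integrand is the identity
     on U. *)
  exists (Num.truncn (nrm l + e)).+1 => // n /= nN.
  have [s [ss sF su]] := hu n.
  have hz z : U z -> (id \_ (S `&` [set z : C | `|z| <= n%:R])) z = z.
    move=> Uz; rewrite patchT// inE; split; first exact: US.
    have -> : n%:R = ofreal n%:R :> C by rewrite /ofreal rmorph_nat.
    rewrite /= nrmE ofreal_le -[z](subrK l).
    apply: le_trans (nrmD _ _) _; apply: le_trans (lerD (hU _ Uz) (lexx _)) _.
    rewrite addrC; apply: le_trans (ltW (truncnS_gt _)) _.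
    by rewrite ler_nat.
  apply: (cvg_nrm_le (E_cvg _ mU su)).
  have [N _ hN] := sF d d0; exists N => // k /= /hN {}hN.
  have ms z : meas (U `&` s k @^-1` [set z]).
    by apply: (@measurableI _ (borelC R)) => //; exact: simple_fiber_meas.
  set r := finmap.enum_fset (fset_set (range (s k))).
  have ur : uniq r by exact: finmap.fset_uniq.
  have disj (i j : C) : i != j ->
      (U `&` s k @^-1` [set i]) `&` (U `&` s k @^-1` [set j]) = set0.
    move=> ij; apply/seteqP; split=> x // [[_ xi] [_ xj]].
    by case/eqP: ij; exact: etrans (esym xi) xj.
  have [//|//|_ hs] := E_family sE f ur (D := fun z => U `&` s k @^-1` [set z]).
    by move=> i j _ _; exact: disj.
  have hU' : E U f = \sum_(z <- r) E (U `&` s k @^-1` [set z]) f.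
    rewrite hs; congr (E _ f); apply/seteqP; split=> x; last by move=> [z _ []].
    move=> Ux; exists (s k x) => //; rewrite in_fset_set; last by have [] := ss k.
    by rewrite inE; exists x.
  rewrite hU' simple_integralE// linear_sum scaler_sumr -sumrB.
  (* A value z taken only outside U may be far from l. Its coefficient can be replaced by 0, since
     the corresponding projection is E of the empty set. *)
  pose a z := if pselect (U `&` s k @^-1` [set z] !=set0) then z - l else 0.
  rewrite (eq_bigr (fun z => a z *: E (U `&` s k @^-1` [set z]) f)); last first.
    move=> z _; rewrite linearZ /= -E_setI//; last exact: simple_fiber_meas.
    rewrite -scalerBl /a; case: pselect => //= h.
    have -> : U `&` s k @^-1` [set z] = set0.
      by apply/seteqP; split=> x // Ux; apply: h; exists x.
    by rewrite E_set0// !scaler0.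
  apply: (@E_comb_bound _ _ _ sE) => //; first by move=> i j _ _; exact: disj.
  - by rewrite ltr_wpDl.
  - move=> z _; rewrite /a; case: pselect => [[x [Ux xz]]|h] /=; last first.
      by rewrite nrm0 addr_ge0// ltW.
    apply: le_trans (nrm_distD x _ _) _; rewrite addrC lerD//; first exact: hU.
    by have := hN x; rewrite nrmE ofreal_lt xz hz// => /ltW.
apply/ler_addgt0Pr => d d0.
have B0 : 0 <= M * nrm f by rewrite mulr_ge0 ?nrm_ge0// (le_trans ler01).
have k0 : 0 < 4 * (M * nrm f) + 1 by rewrite ltr_wpDl// mulr_ge0.
have q0 : 0 < d / (4 * (M * nrm f) + 1) by rewrite divr_gt0.
apply: le_trans (key _ q0) _.
have : d / (4 * (M * nrm f) + 1) * (4 * (M * nrm f) + 1) = d by rewrite divfK ?gt_eqF.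
move: q0; set q := d / _; set B := M * nrm f; nra.
Qed.

(** The case of radius 0 in [graph_bound]. *)
Lemma E_set1_graph f y (l : C) : S l -> op_graph A (f, y) ->
  E [set l] y = l *: E [set l] f.
Proof.
move=> Sl fy; apply/eqP; rewrite -subr_eq0; apply/eqP/nrm0_eq0/eqP.
rewrite eq_le nrm_ge0 andbT.
have := @graph_bound [set l] f y l 0 (set1_meas l) _ (lexx _) _ fy.
rewrite mulr0 mul0r; apply; first by move=> ? ->.
by move=> z ->; rewrite subrr nrm0.
Qed.

Hypothesis dA : densely_defined A.
Hypothesis cA : closed_op A.

Lemma dom_approx f (e : R) : 0 < e -> exists2 g, dom A g & nrm (g - f) < e.
Proof.
move=> e0; have [||g [fg Ag]] := dA (O := (fun g => nbhs g [set x | nrm (x - f) < e])).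
- by exists f; apply/nbhs_nrm; exists e.
- rewrite openE => g /nbhs_interior; apply: filterS => x; exact.
by exists g => //; exact: nbhs_singleton fg.
Qed.

Lemma graph_closed (u v : nat -> X) f g : (forall n, op_graph A (u n, v n)) ->
  u n @[n --> \oo] --> f -> v n @[n --> \oo] --> g -> op_graph A (f, g).
Proof.
move=> huv hu hv.
have FA : \forall n \near \oo, op_graph A (u n, v n) by exact: nearW.
apply: (@closed_cvg nat _ \oo _ (fun n => (u n, v n)) (op_graph A) cA FA (f, g)).
exact: cvg_pair.
Qed.

(** For f in the domain this follows from [graph_E] and [E_set1_graph]. A general f is a limit of
    such vectors, and closedness of A puts the limit pair in the graph; thus E({l}) maps all of X
    into the eigenspace of l. *)
Lemma graph_E_set1 f (l : C) : S l -> op_graph A (E [set l] f, l *: E [set l] f).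
Proof.
move=> Sl; have hn n : exists g, dom A g /\ nrm (g - f) < n.+1%:R^-1.
  have [|g] := @dom_approx f (n.+1%:R^-1); first by rewrite invr_gt0 ltr0n.
  by exists g.
have [u hu] := choice hn.
have uf : u n @[n --> \oo] --> f.
  apply/cvg_nrm => e /invnS_lt[N hN]; exists N => // n /= Nn.
  have [_ h] := hu n; apply: lt_trans h _; apply: le_lt_trans hN.
  by rewrite lef_pV2 ?posrE ?ltr0n// ler_nat ltnS.
have Ef := E_cvg _ (set1_meas l) uf.
apply: (@graph_closed (fun n => E [set l] (u n)) (fun n => l *: E [set l] (u n))) => //.
  move=> n; have [du _] := hu n.
  have /(graph_E (set1_meas l)) : op_graph A (u n, A (u n)) by split.
  by rewrite (@E_set1_graph (u n) (A (u n)) l).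
  exact: Ef.
apply: cvgZ; [exact: cvg_cst|exact: Ef].
Qed.

End SpectralOperator.

(** * Local boundedness of a semigroup and its action on approximate eigenvectors *)

Section Semigroup.
Context {R : realType} {X : completeNormedModType (cplx R)}.
Local Notation C := (cplx R).

Lemma at_rightP (P : set R) : (\forall t \near 0^'+, P t) <->
  exists2 d : R, 0 < d & forall t, 0 < t -> t < d -> P t.
Proof.
split=> [/nbhs_ballP[d /= d0 h]|[d d0 h]].
  exists d => // t t0 td; apply: h => //.
  by rewrite -ball_normE /= sub0r normrN gtr0_norm.
apply/nbhs_ballP; exists d => //= t.
by rewrite -ball_normE /= sub0r normrN => td t0; apply: h => //; rewrite -(gtr0_norm t0).
Qed.

Lemma ler_addgt0_mul (a b k : R) : 0 <= k ->
  (forall e, 0 < e -> a <= b + k * e) -> a <= b.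
Proof.
move=> k0 h; apply/ler_addgt0Pr => d d0.
have k1 : 0 < k + 1 by rewrite ltr_wpDl.
apply: le_trans (h (d / (k + 1)) _) _; first by rewrite divr_gt0.
by rewrite lerD2l mulrCA ler_piMr ?(ltW d0)// ler_pdivrMr// mul1r lerDl.
Qed.

Variables (T : R -> {linear X -> X}) (hT : C0_semigroup T).

(** Otherwise there are times t_n in [0, 1 / (n + 1)] with T(t_n) of norm larger than n + 1. By
    strong continuity at 0 these operators are pointwise bounded, which contradicts uniform
    boundedness. *)
Lemma semigroup_bound : exists d B : R,
  [/\ 0 < d, 1 <= B & forall t f, 0 <= t <= d -> nrm (T t f) <= B * nrm f].
Proof.
have [cT T0 _ rT] := hT; apply: contrapT => hn.
have hv n : exists tf : R * X, 0 <= tf.1 <= n.+1%:R^-1 /\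
    n.+1%:R * nrm tf.2 < nrm (T tf.1 tf.2).
  apply: contrapT => k; apply: hn; exists n.+1%:R^-1, n.+1%:R; split.
  - by rewrite invr_gt0 ltr0n.
  - by rewrite ler1n.
  - by move=> t f td; rewrite leNgt; apply/negP => ?; apply: k; exists (t, f).
have [tf htf] := choice hv.
have [||K K0 hK] := @uniform_boundedness _ _ nat (fun n => T (tf n).1).
- by move=> n; have [/andP[t0 _] _] := htf n; exact: cT.
- move=> x; have /cvg_nrm /(_ 1 ltr01) /at_rightP[d d0 hd] := rT x.
  have [N hN] := invnS_lt d0.
  (* The sum takes care of the indices below N; for the others T(t_n) x is within 1 of x. *)
  exists (\sum_(i < N) nrm (T (tf i).1 x) + (nrm x + 1)) => n.
  have [nN|Nn] := ltnP n N.
    rewrite (bigD1 (Ordinal nN))//= -addrA lerDl addr_ge0//.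
      by apply: sumr_ge0 => i _; exact: nrm_ge0.
    by rewrite addr_ge0// nrm_ge0.
  apply: (@le_trans _ _ (nrm x + 1)); last first.
    by rewrite lerDr; apply: sumr_ge0 => i _; exact: nrm_ge0.
  have [/andP[t0 t1] _] := htf n.
  have [->|tn0] := eqVneq (tf n).1 0; first by rewrite T0 lerDl.
  have /hd hd' : 0 < (tf n).1 by rewrite lt_def tn0.
  rewrite -[X in nrm X](subrK x) addrC; apply: le_trans (nrmD _ _) _.
  rewrite lerD2l; apply/ltW/hd'; apply: le_lt_trans t1 _.
  by apply: le_lt_trans hN; rewrite lef_pV2 ?posrE ?ltr0n// ler_nat ltnS.
- have [_ h] := htf (Num.truncn K).
  have := lt_le_trans h (hK _ _); apply/negP; rewrite -leNgt.
  by rewrite ler_wpM2r ?nrm_ge0// ltW// truncnS_gt.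
Qed.

Variables (d B : R) (d0 : 0 < d) (B1 : 1 <= B).
Hypothesis hB : forall t f, 0 <= t <= d -> nrm (T t f) <= B * nrm f.

(** With q = e^(h l), telescope by T((n+1)h)f - q^(n+1) f = T(nh)(T(h)f - q f) + q (T(nh)f - q^n f).
    The error grows only linearly in n, up to powers of e^(h |l|), because T(nh) is bounded by B
    throughout [0, d]. *)
Lemma semigroup_defect_step (f : X) (l : C) (h : R) n : 0 <= h -> n%:R * h <= d ->
  nrm (T (n%:R * h) f - cexp (ofreal h * l) ^+ n *: f) <=
  n%:R * B * expR (h * nrm l) ^+ n * nrm (T h f - cexp (ofreal h * l) *: f).
Proof.
have [_ T0 TD _] := hT; move=> h0; set q := cexp _; set Q := expR _.
set D := nrm (T h f - q *: f).
have D0 : 0 <= D by exact: nrm_ge0.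
have qQ : nrm q <= Q.
  rewrite nrm_cexp ler_expR; apply: le_trans (ler_norm _) _.
  apply: le_trans (Re_le_nrm _) _.
  by rewrite nrmM nrm_ofreal ger0_norm.
have Q1 : 1 <= Q by rewrite -expR0 ler_expR mulr_ge0 ?nrm_ge0.
elim: n => [|n IH] nh; first by rewrite !mul0r T0 expr0 scale1r subrr nrm0.
have nh' : n%:R * h <= d by apply: le_trans nh; rewrite ler_wpM2r// ler_nat.
have nh0 : 0 <= n%:R * h by rewrite mulr_ge0.
have -> : T (n.+1%:R * h) f - q ^+ n.+1 *: f =
    T (n%:R * h) (T h f - q *: f) + q *: (T (n%:R * h) f - q ^+ n *: f).
  rewrite linearB [T _ (q *: f)]linearZ /= -TD// scalerBr scalerA -exprS.
  rewrite [RHS]addrA subrK.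
  by rewrite -natr1 mulrDl mul1r.
apply: le_trans (nrmD _ _) _; rewrite nrmZ.
have h1 : nrm (T (n%:R * h) (T h f - q *: f)) <= B * D by apply: hB; rewrite nh0.
have h2 := ler_pM (nrm_ge0 q) (nrm_ge0 _) qQ (IH nh').
apply: le_trans (lerD h1 h2) _.
have QS : 1 <= Q ^+ n.+1 by exact: exprn_ege1.
rewrite -natr1 (_ : Q * _ = n%:R * B * Q ^+ n.+1 * D); last by rewrite exprS; ring.
rewrite mulrDl mul1r !mulrDl addrC lerD2l mulrAC ler_peMr//.
by rewrite mulr_ge0// (le_trans ler01).
Qed.

Variables (A : operator X) (gT : generator A T).

(** Apply the previous estimate with N + 1 steps of length h = d / (N + 1). Divided by h, the defect
    of one step tends to y - l f, the step lengths add up to d, and the powers of e^(h |l|) multiply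
    to e^(d |l|). *)
Lemma semigroup_defect f y (l : C) : op_graph A (f, y) ->
  nrm (T d f - cexp (ofreal d * l) *: f) <=
  B * expR (d * nrm l) * d * nrm (y - l *: f).
Proof.
move=> /gT /cvg_nrm hy; have /cvg_nrm hl := @cexp_derive0 R l.
set c := B * _ * _.
have c0 : 0 <= c by rewrite !mulr_ge0 ?expR_ge0 ?(ltW d0)// (le_trans ler01).
apply: (@ler_addgt0_mul _ _ (c * (1 + nrm f))).
  by rewrite mulr_ge0// addr_ge0// nrm_ge0.
move=> e e0.
have [s s0 hs] := (at_rightP _).1 (filterI (hy _ e0) (hl _ e0)).
have [|N hN] := @invnS_lt _ (s / d); first by rewrite divr_gt0.
pose h := d / N.+1%:R.
have n0 : 0 < N.+1%:R :> R by rewrite ltr0n.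
have h0 : 0 < h by rewrite divr_gt0.
have hd : N.+1%:R * h = d by rewrite mulrC divfK// gt_eqF.
have [] := hs h h0 _; first by rewrite /h mulrC -ltr_pdivlMr.
set u := ofreal h^-1 *: _; set w := ofreal h^-1 * _ => hu hw.
have := @semigroup_defect_step f l h N.+1 (ltW h0); rewrite hd lexx => /(_ isT).
have -> : cexp (ofreal h * l) ^+ N.+1 = cexp (ofreal d * l).
  rewrite -cexpMn; congr cexp; rewrite -hd -mulrnAl; congr (_ * _).
  by rewrite /ofreal -rmorphMn -mulr_natl.
have -> : expR (h * nrm l) ^+ N.+1 = expR (d * nrm l).
  by rewrite -expRM_natl mulrA hd.
move/le_trans; apply.
have -> : T h f - cexp (ofreal h * l) *: f = ofreal h *: (u - w *: f).
  rewrite /u /w scalerBr !scalerA mulrA -ofrealM divff ?gt_eqF//.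
  by rewrite mul1r scale1r scalerBl scale1r opprB addrA subrK.
rewrite nrmZ nrm_ofreal gtr0_norm//.
have hb : nrm (u - w *: f) <= nrm (y - l *: f) + (1 + nrm f) * e.
  have -> : u - w *: f = (u - y) + ((y - l *: f) - (w - l) *: f).
    by rewrite scalerBl opprB [y - _ + _]addrA subrK addrA subrK.
  apply: le_trans (nrmD _ _) _; apply: le_trans (lerD (ltW hu) (nrmB _ _)) _.
  rewrite nrmZ addrCA lerD2l mulrDl mul1r lerD2l mulrC.
  by rewrite ler_wpM2l ?nrm_ge0// ltW.
have -> : N.+1%:R * B * expR (d * nrm l) * (h * nrm (u - w *: f)) =
    c * nrm (u - w *: f).
  rewrite /c; move: (expR (d * nrm l)) (nrm (u - w *: f)) => Z W.
  by rewrite -[in RHS]hd; ring.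
by rewrite -mulrA -mulrDr ler_wpM2l.
Qed.

End Semigroup.

(** * Necessity: the spectrum of the generator of an immediately compact semigroup *)

Section Forward.
Context {R : realType} {X : completeNormedModType (cplx R)}.
Local Notation C := (cplx R).
Local Notation meas := (@measurable _ (borelC R)).

Lemma open_halfplane (c : R) : open [set z : C | c < complex.Re z].
Proof.
apply: open_nrm => z /= cz; exists (complex.Re z - c); first by rewrite subr_gt0.
move=> y yz; have := le_lt_trans (Re_le_nrm (y - z)) yz.
by case: y z {cz yz} => [a b] [p q] /=; rewrite ltr_norml => /andP[]; lra.
Qed.

Lemma open_disc (x : C) (r : R) : open [set z : C | nrm (z - x) < r].
Proof.
apply: open_nrm => z /= zr; exists (r - nrm (z - x)); first by rewrite subr_gt0.
by move=> y; rewrite ltrBrDr; apply: le_lt_trans; exact: nrm_distD.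
Qed.

Lemma open_codisc (x : C) (r : R) : open [set z : C | r < nrm (z - x)].
Proof.
apply: open_nrm => z /= zr; exists (nrm (z - x) - r); first by rewrite subr_gt0.
move=> y yz; have := nrm_distD y z x; rewrite [nrm (z - y)]nrm_distC; lra.
Qed.

(** By [exhaustion], where a rich set is an open set containing infinitely many points of Z. *)
Lemma disjoint_open_nbhs (Z : set C) : infinite_set Z ->
  exists2 V : nat -> set C, trivIset setT V &
    forall n, open (V n) /\ exists2 z, V n z & Z z.
Proof.
move=> Zinf; pose Q (D : set C) := open D /\ infinite_set (D `&` Z).
have Q0 : Q setT by split; [exact: openT|rewrite setTI].
apply: (exhaustion (Q := Q) (G := fun V => open V /\ exists2 z, V z & Z z) Q0) => D [oD iD].
have [x [Dx Zx]] := infinite_setN0 iD.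
have [y [[Dy Zy] /= /eqP yx]] := infinite_setN0 (infinite_setD iD (finite_set1 x)).
(* If infinitely many points of Z in D lie farther than r from x, split off the disc around x.
   Otherwise all but finitely many are within r of x, hence at distance at least 2r from y, and the
   disc around y is split off. *)
pose r := nrm (y - x) / 3.
have r0 : 0 < r by rewrite divr_gt0// nrm_gt0// subr_eq0.
pose V z := D `&` [set w | nrm (w - z) < r].
pose D' z := D `&` [set w | r < nrm (w - z)].
have key z : D z -> Z z -> infinite_set (D' z `&` Z) ->
    exists V D', [/\ V `<=` D, D' `<=` D, V `&` D' = set0,
      open V /\ (exists2 z, V z & Z z) & Q D'].
  move=> Dz Zz iz; exists (V z), (D' z); split.
  - by move=> w [].
  - by move=> w [].
  - by apply/seteqP; split=> // w [[_ /= h1] [_ /= h2]]; have := lt_trans h1 h2; rewrite ltxx.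
  - split; first exact: openI oD (@open_disc z r).
    by exists z => //; split=> //=; rewrite subrr nrm0.
  - by split=> //; exact: openI oD (@open_codisc z r).
have [fx|] := pselect (finite_set (D' x `&` Z)); last exact: key Dx Zx.
apply: (key y Dy Zy); apply: sub_infinite_set (infinite_setD iD fx).
move=> w [[Dw Zw] nw]; split=> //; split=> //=.
have wx : nrm (w - x) <= r by rewrite leNgt; apply/negP => ?; apply: nw.
have := nrm_distD w y x; rewrite [nrm (y - w)]nrm_distC.
have : nrm (y - x) = r * 3 by rewrite divfK.
lra.
Qed.

Lemma finite_nat_bound (N : set nat) : finite_set N ->
  exists m, forall n, N n -> (n <= m)%N.
Proof.
move=> fN; exists (\max_(i <- finmap.enum_fset (fset_set N)) i) => n Nn.
by apply: (leq_bigmax_seq n) => //; rewrite in_fset_set// inE.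
Qed.

Section Discrete.
Variables (S : set C).
Hypothesis finS : forall c : R, finite_set [set z | S z /\ c <= complex.Re z].

(** From the half-plane Re w > Re z - 1, remove the finitely many other points of S. *)
Lemma halfplanes_isolated z : exists U, [/\ open U, U z & forall w, U w -> S w -> w = z].
Proof.
pose F := [set w | S w /\ complex.Re z - 1 <= complex.Re w] `\ z.
have fF : finite_set F by exact: finite_setD.
exists ([set w : C | complex.Re z - 1 < complex.Re w] `&` ~` F); split.
- apply: openI; first exact: open_halfplane.
  apply: closed_openC; apply: (accessible_finite_set_closed.1 _ _ fF).
  exact/hausdorff_accessible/norm_hausdorff.
- by split; [rewrite /= ltrBlDr ltrDl|move=> [_]; apply].
- move=> w [/= zw nF] Sw; apply: contrapT => wz; apply: nF; split=> //; split=> //.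
  exact: ltW.
Qed.

Lemma halfplanes_countable : countable S.
Proof.
have -> : S = \bigcup_n [set z | S z /\ - n%:R <= complex.Re z].
  apply/seteqP; split=> z; last by move=> [n _ []].
  move=> Sz; exists (Num.truncn `|complex.Re z|).+1 => //; split=> //.
  by rewrite lerNl; apply: le_trans (ltW (truncnS_gt _)); rewrite -normrN ler_norm.
by apply: bigcup_countable => // n _; exact: finite_set_countable.
Qed.

Lemma halfplanes_limit_point : limit_point S = set0.
Proof.
apply/seteqP; split=> // z /= hz.
have [U [oU Uz hU]] := halfplanes_isolated z.
have [y [/eqP yz Sy Uy]] := hz U (open_nbhs_nbhs (conj oU Uz)).
exact/yz/hU.
Qed.

Lemma halfplanes_Re_cvg (l : nat -> C) : arrangement S l ->
  complex.Re (l n) @[n --> \oo] --> -oo.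
Proof.
move=> [lS linj _]; apply/cvgrNyPle => c.
pose N := [set n | (0 < n)%N /\ c <= complex.Re (l n)].
have fN : finite_set N.
  suff : finite_set (l @` N).
    rewrite (eq_finite_set (inj_card_eq _))// => m n /set_mem[m0 _] /set_mem[n0 _].
    by apply: linj; rewrite inE.
  apply: sub_finite_set (finS c) => _ [n [n0 cn] <-]; split=> //; exact: lS.
have [m hm] := finite_nat_bound fN.
exists m.+1 => // n /= mn; rewrite leNgt; apply/negP => cn.
have /hm : N n by split; [exact: leq_trans mn|exact: ltW].
by rewrite leqNgt mn.
Qed.

End Discrete.

Variable A : operator X.

Lemma app0 : A 0 = 0.
Proof.
have := app_lin (-1) (dom_zero A) (dom_zero A).
by rewrite scaler0 addr0 scaleN1r addNr.
Qed.

Lemma eigenspace0 z : op_eigenspace A z 0.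
Proof. by split; [exact: dom_zero|rewrite app0 scaler0 subrr]. Qed.

Lemma eigenspace_lin z (a : C) x y : op_eigenspace A z x -> op_eigenspace A z y ->
  op_eigenspace A z (a *: x + y).
Proof.
move=> [dx hx] [dy hy]; split; first exact: dom_lin.
rewrite app_lin// scalerDr opprD addrACA hy addr0 scalerA mulrC -scalerA.
by rewrite -scalerBr hx scaler0.
Qed.

Variables (E : set C -> {linear X -> X}) (sE : spectral_measure E).
Let S := spectral_support E.
Hypothesis hG : forall f y, op_graph A (f, y) <-> is_spectral_integral E S id f y.
Variables (M : R) (M1 : 1 <= M).
Hypothesis hM : forall D f, meas D -> nrm (E D f) <= M * nrm f.
Hypothesis dA : densely_defined A.
Hypothesis cA : closed_op A.

Lemma dom_E_neq0 U f : meas U -> E U f <> 0 -> exists2 g, dom A g & E U g <> 0.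
Proof.
move=> mU /eqP Uf; have n0 := nrm_gt0 Uf; have M0 : 0 < M by exact: lt_le_trans ltr01 M1.
have [|g dg gf] := @dom_approx _ _ A dA f (nrm (E U f) / M); first by rewrite divr_gt0.
exists g => // Ug; have := hM (g - f) mU; rewrite linearB Ug sub0r nrmN.
by apply/negP; rewrite -ltNge mulrC -ltr_pdivlMr.
Qed.

(** The projection of a small neighbourhood of l is nonzero because l is in the support, and nonzero
    on some vector of the domain by density. That projected vector, normalised, is the approximate
    eigenvector; the radius e / (4M) cancels the constant of [graph_bound]. *)
Lemma approx_eigenvector V (l : C) (e : R) : open V -> V l -> S l -> 0 < e ->
  exists U f g, [/\ U `<=` V, meas U, op_graph A (f, g), E U f = f & nrm f = 1] /\
    nrm (g - l *: f) <= e.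
Proof.
move=> oV Vl Sl e0; have M0 : 0 < M by exact: lt_le_trans ltr01 M1.
pose r := e / (4 * M); have r0 : 0 < r by rewrite divr_gt0// mulr_gt0.
pose W := V `&` [set z | nrm (z - l) < r].
have oW : open W by exact: openI oV (@open_disc l r).
have [|f0 hf0] := Sl W oW; first by split=> //=; rewrite subrr nrm0.
have mW := open_meas oW; pose U := W `&` S.
have mU : meas U.
  by apply: (@measurableI _ (borelC R)) => //; apply: closed_meas; exact: supp_closed.
have [|f1 df1 hf1] := @dom_E_neq0 U f0 mU; first by rewrite E_suppI.
have G1 : op_graph A (f1, A f1) by split.
have [dh Ah] := graph_E sE hG mU G1.
set h := E U f1 in dh Ah hf1; set k := E U (A f1) in Ah.
have Uh : E U h = h by exact: E_idem.
have Uk : E U k = k by exact: E_idem.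
have h0 : 0 < nrm h by apply/nrm_gt0/eqP.
have hk : nrm (k - l *: h) <= e * nrm h.
  have := @graph_bound _ _ E sE M M1 hM A hG U h k l r mU.
  rewrite Uh Uk (_ : 4 * r * (M * nrm h) = e * nrm h); last first.
    by rewrite /r; field; rewrite gt_eqF.
  apply=> //; [by move=> z []|exact: ltW|by move=> z [[_ /= /ltW]]].
pose b : C := ofreal (nrm h)^-1.
have nb : nrm b = (nrm h)^-1 by rewrite nrm_ofreal gtr0_norm// invr_gt0.
exists U, (b *: h), (b *: k); split; first split => //.
- by move=> z [[]].
- split=> /=; first by rewrite -[_ *: _]addr0; exact: dom_lin dh (dom_zero A).
  rewrite -[b *: h]addr0 app_lin//; last exact: dom_zero.
  by rewrite app0 addr0 -[k]Ah.
- by rewrite linearZ /= Uh.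
- by rewrite nrmZ nb mulVf// gt_eqF.
- rewrite scalerA mulrC -scalerA -scalerBr nrmZ nb mulrC ler_pdivrMr//.
Qed.

Variables (T : R -> {linear X -> X}) (hT : C0_semigroup T) (gT : generator A T).
Hypothesis cT : immediately_compact T.

Lemma spectrum_halfplane (c : R) : finite_set [set z | S z /\ c <= complex.Re z].
Proof.
apply: contrapT => /disjoint_open_nbhs[V tV hV].
have [d [B [d0 B1 hB]]] := semigroup_bound hT.
have M0 : 0 < M by exact: lt_le_trans ltr01 M1.
(* K bounds |e^(d l)| from below when Re l >= c. The error e = K / (4M) is chosen so that two
   errors, after a projection of norm at most M, use up only half of K. *)
pose K := expR (d * c); have K0 : 0 < K by exact: expR_gt0.
pose e := K / (4 * M); have e0 : 0 < e by rewrite divr_gt0// mulr_gt0.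
have step n : exists p : C * set C * X,
    [/\ p.1.2 `<=` V n, meas p.1.2, E p.1.2 p.2 = p.2, nrm p.2 = 1 & c <= complex.Re p.1.1] /\
    nrm (T d p.2 - cexp (ofreal d * p.1.1) *: p.2) <= e.
  have [oV [l Vl [Sl cl]]] := hV n.
  have q0 : 0 < B * expR (d * nrm l) * d.
    by rewrite !mulr_gt0 ?expR_gt0//; exact: lt_le_trans ltr01 B1.
  (* The tolerance is e divided by the factor that [semigroup_defect] puts in front of |A f - l
     f|. *)
  have [|U [f [g [[UV mU fg Uf nf] hf]]]] :=
    @approx_eigenvector (V n) l (e / (B * expR (d * nrm l) * d)) oV Vl Sl.
    by rewrite divr_gt0.
  exists (l, U, f); split=> //=.
  apply: le_trans (semigroup_defect hT d0 B1 hB gT l fg) _.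
  by rewrite mulrC -ler_pdivlMr.
have [p hp] := choice step.
pose u n := (p n).2.
have [|||m [n [mn]]] := @precompact_close _ _ _ (fun n => T d (u n)) e
  (cT d0 (_ : bounded_set [set f | nrm f <= 1])).
- by apply/bounded_setP; exists 1.
- by move=> n; exists (u n) => //=; have [[_ _ _ ->]] := hp n.
- exact: e0.
have [[UVm mUm Em nm cm] hm] := hp m; have [[UVn mUn En nn cn] hn] := hp n.
rewrite -/(u m) -/(u n) in Em En nm nn hm hn.
set a := cexp _ in hm; set b := cexp _ in hn; set U := (p m).1.2 in UVm mUm Em.
have UU : E U (u n) = 0.
  rewrite -En -E_setI// (_ : U `&` _ = set0) ?E_set0//.
  apply/seteqP; split=> // x [/UVm xm /UVn xn].
  have /(tV m n I I) mn' : V m `&` V n !=set0 by exists x.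
  by rewrite mn' ltnn in mn.
have Ka : K <= nrm a.
  rewrite nrm_cexp ler_expR; case: (p m).1.1 cm => x y /= cx.
  by rewrite mul0r subr0 ler_pM2l.
apply/negP; rewrite -leNgt.
(* E(U) fixes u_m and kills u_n, so it recovers a u_m from the difference of the images up to two
   small errors. *)
have h1 : a *: u m = E U (T d (u m) - T d (u n)) - E U (T d (u m) - a *: u m)
    + E U (T d (u n) - b *: u n).
  rewrite !linearB [E U (a *: _)]linearZ [E U (b *: _)]linearZ /= Em UU scaler0 subr0.
  by rewrite opprK addrAC subrK addrA subrr add0r.
have h2 : nrm a <= M * nrm (T d (u m) - T d (u n)) + M * e + M * e.
  have -> : nrm a = nrm (a *: u m) by rewrite nrmZ nm mulr1.
  rewrite h1; apply: le_trans (nrmD _ _) _; apply: lerD.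
    apply: le_trans (nrmB _ _) _; apply: lerD; first exact: hM.
    by apply: le_trans (hM _ mUm) _; rewrite ler_pM2l.
  by apply: le_trans (hM _ mUm) _; rewrite ler_pM2l.
have Me : M * e = K / 4 by rewrite /e; field; rewrite gt_eqF.
rewrite -(ler_pM2l M0) Me; lra.
Qed.

(** For an exact eigenvector [semigroup_defect] gives T(d) f = e^(d z) f, so the compact operator
    T(d) is bounded below on the eigenspace. *)
Lemma eigenspace_fin_dim z : fin_dim (op_eigenspace A z).
Proof.
have [d [B [d0 B1 hB]]] := semigroup_bound hT.
apply: (@fin_dim_compact _ _ _ (T d) (nrm (cexp (ofreal d * z)))^-1).
- exact: eigenspace0.
- exact: eigenspace_lin.
- exact: cT.
- move=> f [df hf].
  have fG : op_graph A (f, A f) by split.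
  have := semigroup_defect hT d0 B1 hB gT z fG.
  rewrite hf nrm0 mulr0 => h.
  have /nrm0_eq0/eqP : nrm (T d f - cexp (ofreal d * z) *: f) = 0.
    by apply/eqP; rewrite eq_le h nrm_ge0.
  rewrite subr_eq0 => /eqP ->; rewrite nrmZ mulrA mulVf ?mul1r//.
  by rewrite gt_eqF// nrm_gt0// cexp_neq0.
Qed.

(** As z is isolated in S, E({z}) agrees with E(U) for a neighbourhood U of z and is therefore
    nonzero; its range consists of eigenvectors and 0. *)
Lemma spectrum_eigenvalue z : S z -> op_eigenvalue A z.
Proof.
move=> Sz; have [U [oU Uz hU]] := halfplanes_isolated spectrum_halfplane z.
have [f hf] := Sz U oU Uz.
have Uz1 : U `&` S = [set z].
  by apply/seteqP; split=> [w []|w ->]; [exact: hU|split].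
have Ef : E [set z] f <> 0 by rewrite -Uz1 E_suppI//; exact: open_meas.
have [dz Az] := @graph_E_set1 _ _ E sE M M1 hM A hG dA cA f z Sz.
by exists (E [set z] f) => //; split=> //; rewrite Az subrr.
Qed.

(** If S is finite, every f is the finite sum of the E({z}) f, so X is spanned by finitely many
    finite-dimensional eigenspaces. *)
Lemma spectrum_infinite : ~ fin_dim [set: X] -> ~ finite_set S.
Proof.
move=> infX fS; apply: infX.
have hl z : exists l, op_eigenspace A z `<=` lspan l.
  exact/fin_dim_sub_lspan/eigenspace_fin_dim.
have [l hl'] := choice hl.
set r := finmap.enum_fset (fset_set S).
have rS z : z \in r -> S z by rewrite /r in_fset_set// inE.
have -> : [set: X] = lspan (flatten [seq l z | z <- r]); last exact: fin_dim_lspan.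
apply/seteqP; split=> // f _.
have [||_ hs] := @E_family _ _ E sE _ r (fun z => [set z]) f (finmap.fset_uniq _).
- by move=> z _; exact: set1_meas.
- move=> i j _ _ /eqP ij; apply/seteqP; split=> // x [/= -> h]; exact: ij.
have <- : E setT f = f by exact: E_setT.
rewrite -(E_suppI sE f measurableT) setTI.
have -> : spectral_support E = [set x | exists2 i, i \in r & [set i] x].
  apply/seteqP; split=> x; last by move=> [z /rS Sz ->].
  by move=> Sx; exists x => //; rewrite /r in_fset_set// inE.
rewrite -hs big_seq; apply: (big_ind (lspan _)).
- exact: lspan0.
- by move=> x y; exact: lspanD.
- move=> z zr; have [dz Az] := @graph_E_set1 _ _ E sE M M1 hM A hG dA cA f z (rS _ zr).
  apply: (@lspan_sub _ _ (l z) (lspan _)).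
  + exact: lspan0.
  + by move=> a x y; exact: lspan_lin.
  + by move=> x xl; apply: lspan_mem; apply/flatten_mapP; exists z.
  + by apply: hl'; split=> //; rewrite Az subrr.
Qed.

End Forward.

(** * Diagonal operators and the semigroup of multipliers e^(t l_n) *)

Section Decomposition.
Context {R : realType} {X : completeNormedModType (cplx R)}.
Local Notation C := (cplx R).

Variables (P : nat -> {linear X -> X}) (K : R).
Hypothesis K0 : 0 < K.
Hypothesis P_continuous : forall n, continuous (P n).
Hypothesis P_orth : forall n m f, P n (P m f) = if n == m then P n f else 0.
Hypothesis P_sum : forall f, \sum_(0 <= i < n) P i f @[n --> \oo] --> f.
Hypothesis P_bound : forall (r : seq nat) (a : nat -> C) (L : R) f, uniq r -> 0 < L ->
  (forall n, nrm (a n) <= L) -> nrm (\sum_(i <- r) a i *: P i f) <= K * L * nrm f.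

Lemma P_inj f g : (forall n, P n f = P n g) -> f = g.
Proof.
move=> h; apply: (cvg_nrm_unique (@P_sum f)).
rewrite (_ : (fun n => _) = (fun n => \sum_(0 <= i < n) P i g)); first exact: P_sum.
by apply/funext => n; apply: eq_bigr.
Qed.

Lemma P_comb n N (a : nat -> C) f :
  P n (\sum_(0 <= i < N) a i *: P i f) = if (n < N)%N then a n *: P n f else 0.
Proof.
rewrite linear_sum; elim: N => [|N IH]; first by rewrite big_nil.
rewrite big_nat_recr//= IH linearZ /= P_orth [in RHS]ltnS [in RHS]leq_eqVlt.
by case: (eqVneq n N) => [->|_] /=; rewrite ?ltnn ?add0r// scaler0 addr0.
Qed.

Lemma P_sub n N f :
  P n (f - \sum_(0 <= i < N) P i f) = if (n < N)%N then 0 else P n f.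
Proof.
have -> : \sum_(0 <= i < N) P i f = \sum_(0 <= i < N) 1 *: P i f.
  by apply: eq_bigr => i _; rewrite scale1r.
by rewrite linearB P_comb scale1r; case: ifP; rewrite ?subrr// subr0.
Qed.

Lemma multiplier_bound (m : nat -> C) (L : R) f y : 0 < L ->
  (forall n, nrm (m n) <= L) -> (forall n, P n y = m n *: P n f) ->
  nrm y <= K * L * nrm f.
Proof.
move=> L0 hm hy; rewrite -[y]subr0; apply: (cvg_nrm_le (@P_sum y)).
apply: nearW => n; rewrite subr0; under eq_bigr do rewrite hy.
exact: P_bound (iota_uniq _ _) L0 hm.
Qed.

(** The sums of m_i P_i f are Cauchy: the block from N to n is a combination of the coordinates of
    the corresponding block of f, so its norm is at most K L times that of a block of a convergent
    series. *)
Lemma multiplier_exists (m : nat -> C) (L : R) f : 0 < L ->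
  (forall n, nrm (m n) <= L) -> exists y, forall n, P n y = m n *: P n f.
Proof.
move=> L0 hm; pose s N := \sum_(0 <= i < N) m i *: P i f.
have KL : 0 < K * L by exact: mulr_gt0.
have [y sy] : exists y : X, s n @[n --> \oo] --> y.
  apply: cauchyX => e e0; have e2 : 0 < e / (K * L) / 2 by rewrite !divr_gt0.
  have /cvg_nrm /(_ _ e2)[N _ hN] := @P_sum f; exists N => n Nn.
  pose S k := f - \sum_(0 <= i < k) P i f.
  have -> : s n - s N = \sum_(N <= i < n) m i *: P i (S N - S n).
    rewrite /s (big_cat_nat (n := N))//= addrAC subrr add0r.
    apply: eq_big_nat => i /andP[Ni ni].
    by rewrite linearB !P_sub ni ltnNge Ni /= subr0.
  apply: le_trans (P_bound _ (iota_uniq _ _) L0 hm) _.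
  rewrite mulrC -ler_pdivlMr//; apply: le_trans (nrmB _ _) _.
  by rewrite [leRHS]splitr lerD// nrm_distC ltW// hN /=.
exists y => n; apply: (@cvg_nrm_unique _ _ _ \oo _ (fun N => P n (s N))).
  by apply: linear_cvg sy; exact: P_continuous.
apply/cvg_nrm => e e0; exists n.+1 => // N /= nN.
by rewrite P_comb nN subrr nrm0.
Qed.

Lemma multiplier_op (m : nat -> C) (L : R) : 0 < L ->
  (forall n, nrm (m n) <= L) -> exists B : {linear X -> X},
    forall n f, P n (B f) = m n *: P n f.
Proof.
move=> L0 hm; have [B hB] := choice (fun f => multiplier_exists f L0 hm).
have linB : linear B.
  move=> a f g; apply: P_inj => n.
  rewrite hB [P n (a *: f + g)]linearP [P n (a *: B f + B g)]linearP !hB.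
  by rewrite scalerDr !scalerA mulrC.
pose BL : {linear X -> X} := HB.pack B (GRing.isLinear.Build _ _ _ _ B linB).
by exists BL => n f; exact: hB.
Qed.

(* Dominated convergence for multipliers: the tails of [f] are small. *)
Lemma multiplier_cvg0 {T : Type} (F : set_system T) {FF : Filter F} (m : T -> nat -> C)
    (L : R) (y : T -> X) f : 0 < L ->
  (\forall t \near F, forall n, nrm (m t n) <= L) ->
  (\forall t \near F, forall n, P n (y t) = m t n *: P n f) ->
  (forall n, m t n @[t --> F] --> (0 : C)) -> y t @[t --> F] --> (0 : X).
Proof.
move=> L0 hm hy m0; apply/cvg_nrm => e e0.
have KL : 0 < K * L by exact: mulr_gt0.
have e2 : 0 < e / 2 / (K * L) by rewrite !divr_gt0.
have /cvg_nrm /(_ _ e2)[N _ /(_ N (leqnn _)) hN] := @P_sum f.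
(* The tail beyond N is small by the uniform bound L on multipliers; the head is small because its
   finitely many coefficients all tend to 0. *)
pose H := \sum_(0 <= i < N) nrm (P i f).
have H0 : 0 <= H by apply: sumr_ge0 => i _; exact: nrm_ge0.
have H1 : 0 < H + 1 by rewrite ltr_wpDl.
have e3 : 0 < e / 2 / (H + 1) by rewrite !divr_gt0.
have hmN : \forall t \near F, forall i : 'I_N, nrm (m t i) < e / 2 / (H + 1).
  apply: filter_forall => i; have /cvg_nrm /(_ _ e3) := m0 i.
  by apply: filterS => t; rewrite subr0.
apply: filterS3 hm hy hmN => t hmt hyt ht.
pose s := \sum_(0 <= i < N) m t i *: P i f.
rewrite subr0 -[y t](subrK s); apply: le_lt_trans (nrmD _ _) _.
rewrite [ltRHS]splitr; apply: ler_ltD.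
  apply: le_trans (_ : K * L * nrm (f - \sum_(0 <= i < N) P i f) <= _).
    apply: (@multiplier_bound (m t)) => // n.
    rewrite P_sub linearB P_comb hyt.
    by case: ifP; rewrite ?subrr ?scaler0// subr0.
  by rewrite mulrC -ler_pdivlMr// nrm_distC ltW.
apply: le_lt_trans (nrm_sum _ _ _) _.
apply: (@le_lt_trans _ _ (e / 2 / (H + 1) * H)); last first.
  by rewrite -mulrA gtr_pMr ?divr_gt0// mulrC ltr_pdivrMr// mul1r ltrDl.
rewrite mulr_sumr; apply: ler_sum_nat => i /andP[_ iN].
by rewrite nrmZ ler_wpM2r ?nrm_ge0//; exact: ltW (ht (Ordinal iN)).
Qed.

Variables (l : nat -> C) (w : R).
Hypothesis w0 : 0 <= w.
Hypothesis l_le : forall n, complex.Re (l n) <= w.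

Lemma nrm_cexp_le (t : R) n : 0 <= t -> nrm (cexp (ofreal t * l n)) <= expR (t * w).
Proof.
move=> t0; rewrite nrm_cexp ler_expR; have := l_le n; case: (l n) => x y /= xw.
by rewrite mul0r subr0 ler_wpM2l.
Qed.

Variable T : R -> {linear X -> X}.
Hypothesis PT : forall t, 0 <= t -> forall n f,
  P n (T t f) = cexp (ofreal t * l n) *: P n f.

Lemma T_continuous t : 0 <= t -> continuous (T t).
Proof.
move=> t0; apply: (@bound_continuous _ _ _ (K * expR (t * w))) => f.
apply: (@multiplier_bound (fun n => cexp (ofreal t * l n))); first exact: expR_gt0.
- by move=> n; exact: nrm_cexp_le.
- by move=> n; exact: PT.
Qed.

Lemma near_right_le1 : \forall t \near (0 : R)^'+, 0 < t /\ t <= 1.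
Proof.
by apply/at_rightP; exists 1 => // t t0 /ltW.
Qed.

Lemma nrm_cexpB1_le t n : 0 < t -> t <= 1 ->
  nrm (cexp (ofreal t * l n) - 1) <= 3 * expR w * (t * nrm (l n)).
Proof.
move=> t0 t1; apply: le_trans (nrm_cexpB1 _) _.
rewrite nrmM nrm_ofreal gtr0_norm// ler_wpM2r//.
  by rewrite mulr_ge0 ?nrm_ge0// ltW.
rewrite ler_pM2l// ler_expR ge_max w0 /=.
have := l_le n; case: (l n) => x y /= xw; rewrite mul0r subr0.
by apply: le_trans (_ : t * w <= _); [rewrite ler_pM2l|rewrite ler_piMl].
Qed.

Lemma T_C0 : C0_semigroup T.
Proof.
split.
- exact: T_continuous.
- move=> f; apply: P_inj => n; rewrite PT// (_ : ofreal 0 * l n = 0) ?cexp0 ?scale1r//.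
  by rewrite /ofreal rmorph0 mul0r.
- move=> s t f s0 t0; apply: P_inj => n; rewrite !PT ?addr_ge0//.
  by rewrite ofrealD mulrDl cexpD scalerA.
- move=> f; suff h : T t f - f @[t --> 0^'+] --> (0 : X).
    apply/cvg_nrm => e e0; have /cvg_nrm /(_ _ e0) := h.
    by apply: filterS => t; rewrite subr0.
  (* T(t) - I is the multiplier e^(t l_n) - 1, bounded by e^w + 1 for t <= 1 and tending to 0 for
     each n. *)
  apply: (@multiplier_cvg0 _ _ _ (fun t n => cexp (ofreal t * l n) - 1) (expR w + 1) _ f).
  + by rewrite addr_gt0// expR_gt0.
  + apply: filterS near_right_le1 => t [t0 t1] n; apply: le_trans (nrmB _ _) _.
    rewrite nrm1 lerD2r; apply: le_trans (nrm_cexp_le _ (ltW t0)) _.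
    by rewrite ler_expR ler_piMl.
  + apply: filterS near_right_le1 => t [/ltW t0 _] n.
    by rewrite linearB PT// scalerBl scale1r.
  + move=> n; apply/cvg_nrm => e e0; have n0 := nrm_ge0 (l n).
    have q0 : 0 < 3 * expR w * (nrm (l n) + 1).
      by rewrite !mulr_gt0 ?expR_gt0// ltr_wpDl.
    apply/at_rightP; exists (Num.min 1 (e / (3 * expR w * (nrm (l n) + 1)))).
      by rewrite lt_min ltr01 divr_gt0.
    move=> t t0; rewrite lt_min ltr_pdivlMr// => /andP[t1 te]; rewrite subr0.
    apply: le_lt_trans (nrm_cexpB1_le _ t0 (ltW t1)) _.
    apply: le_lt_trans te; rewrite mulrCA ler_pM2l// ler_pM2l ?mulr_gt0 ?expR_gt0//.
    by rewrite lerDl.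
Qed.

Lemma P_quotient t n f : 0 < t -> P n (ofreal t^-1 *: (T t f - f)) =
  (ofreal t^-1 * (cexp (ofreal t * l n) - 1)) *: P n f.
Proof.
move=> t0; rewrite linearZ /= [P n (_ - _)]linearB PT ?(ltW t0)//.
by rewrite -scalerA scalerBl scale1r.
Qed.

Variable A : operator X.
Hypothesis A_graph : forall f g, op_graph A (f, g) <-> forall n, P n g = l n *: P n f.

(** If the difference quotients converge to g, applying P_n gives P_n g = l_n P_n f. Conversely, the
    error of the difference quotient is written as a multiplier acting on g, to which dominated
    convergence applies. *)
Lemma T_generator : generator A T.
Proof.
move=> f g; split=> [/A_graph hfg|hfg]; last first.
  apply/A_graph => n.
  apply: (@cvg_nrm_unique _ _ _ (0 : R)^'+ _ (fun t => P n (ofreal t^-1 *: (T t f - f)))).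
    by apply: linear_cvg hfg; exact: P_continuous.
  have h := @cexp_derive0 R (l n).
  have : (ofreal t^-1 * (cexp (ofreal t * l n) - 1)) *: P n f @[t --> 0^'+] --> l n *: P n f.
    by apply: cvgZ; [exact: h|exact: cvg_cst].
  move=> /cvg_nrm k; apply/cvg_nrm => e /k; apply: filterS2 near_right_le1 => t [t0 _].
  by rewrite P_quotient.
(* The absolute error of the quotient need not be bounded in n, but the error relative to l_n is,
   and P_n g = l_n P_n f absorbs the division. Where l_n = 0 both the quotient and P_n g vanish. *)
pose m t n : C := if l n == 0 then 0 else
  (ofreal t^-1 * (cexp (ofreal t * l n) - 1) - l n) / l n.
suff h : (ofreal t^-1 *: (T t f - f) - g) @[t --> 0^'+] --> (0 : X).
  apply/cvg_nrm => e e0; have /cvg_nrm /(_ _ e0) := h.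
  by apply: filterS => t; rewrite subr0.
have eE : 0 < expR w by exact: expR_gt0.
apply: (@multiplier_cvg0 _ _ _ m (3 * expR w + 1) _ g).
- by rewrite addr_gt0// mulr_gt0.
- apply: filterS near_right_le1 => t [t0 t1] n; rewrite /m.
  have [l0|l0] := eqVneq (l n) 0; first by rewrite nrm0 addr_ge0// mulr_ge0// ltW.
  rewrite mulrBl divff//; apply: le_trans (nrmB _ _) _; rewrite nrm1 lerD2r.
  have ln0 := nrm_gt0 l0; rewrite -(ler_pM2r ln0) -nrmM mulrVK ?unitfE//.
  rewrite nrmM nrm_ofreal gtr0_norm ?invr_gt0// mulrC ler_pdivrMr//.
  by apply: le_trans (nrm_cexpB1_le _ t0 t1) _; rewrite mulrA mulrAC.
- apply: filterS near_right_le1 => t [t0 t1] n.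
  rewrite linearB P_quotient// /m hfg.
  have [l0|l0] := eqVneq (l n) 0.
    by rewrite l0 mulr0 cexp0 subrr mulr0 !scale0r subrr.
  by rewrite scalerA mulrVK ?unitfE// -scalerBl.
- move=> n; rewrite /m; have [l0|l0] := eqVneq (l n) 0; first exact: cvg_cst.
  have ln0 := nrm_gt0 l0.
  apply/cvg_nrm => e e0; have /cvg_nrm h := @cexp_derive0 R (l n).
  have /h : 0 < e * nrm (l n) by exact: mulr_gt0.
  apply: filterS => t ht; rewrite subr0 -(ltr_pM2r ln0) -nrmM mulrVK ?unitfE//.
Qed.

Hypothesis l_cvg : complex.Re (l n) @[n --> \oo] --> -oo.
Hypothesis P_fin_dim : forall n, exists s, forall f, lspan s (P n f).

Lemma P_le n f : nrm (P n f) <= K * nrm f.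
Proof.
have := @P_bound [:: n] (fun _ => 1) 1 f isT ltr01 (fun _ => _).
by rewrite big_seq1 scale1r mulr1; apply => _; rewrite nrm1.
Qed.

Lemma T_compact : immediately_compact T.
Proof.
move=> t t0 B /bounded_setP[b hb]; apply: totally_bounded_precompact.
have b0 : 0 < `|b| + 1 by rewrite ltr_wpDl.
have {}hb f : B f -> nrm f <= `|b| + 1.
  by move=> /hb h; apply: le_trans h _; rewrite ler_wpDr// ler_norm.
set b1 := `|b| + 1 in b0 hb.
pose m n := cexp (ofreal t * l n).
(* Each added term stays in a bounded part of a finite-dimensional span. *)
have head N : totally_bounded [set \sum_(0 <= i < N) m i *: P i f | f in B].
  elim: N => [|N IH].
    by move=> e e0; exists [:: 0] => _ [f _ <-]; exists 0; rewrite ?mem_head// big_geq// subrr nrm0.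
  have [s hs] := P_fin_dim N.
  apply: totally_bounded_subset (totally_bounded_add IH
    (totally_bounded_lspan s (nrm (m N) * (K * b1)))).
  move=> _ [f Bf <-]; exists (\sum_(0 <= i < N) m i *: P i f), (m N *: P N f).
  split; [by exists f| |by rewrite big_nat_recr].
  split; first exact: lspanZ.
  rewrite nrmZ ler_wpM2l ?nrm_ge0//; apply: le_trans (P_le _ _) _.
  by rewrite ler_pM2l// hb.
apply: totally_bounded_approx => e e0.
pose q := e / (K * b1); have q0 : 0 < q by rewrite divr_gt0// mulr_gt0.
(* |e^(t l_n)| <= q as soon as Re l_n <= ln q / t. With q = e / (K b1) the tail multiplier, set to 0
   on the head, moves vectors of B by at most e. *)
have [N _ hN] : \forall n \near \oo, nrm (m n) <= q.
  have := l_cvg => /cvgrNyPle /(_ (ln q / t)); apply: filterS => n.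
  rewrite ler_pdivlMr// => h; rewrite nrm_cexp -[leRHS]lnK ?posrE// ler_expR.
  by case: (l n) h => x y /=; rewrite mul0r subr0 mulrC.
exists [set \sum_(0 <= i < N) m i *: P i f | f in B] => // _ [f Bf <-].
exists (\sum_(0 <= i < N) m i *: P i f); first by exists f.
apply: (@le_trans _ _ (K * q * nrm f)).
  apply: (@multiplier_bound (fun n => if (n < N)%N then 0 else m n)) => // n.
    by case: ltnP => [_|/hN//]; rewrite nrm0 ltW.
  rewrite linearB PT ?(ltW t0)// P_comb.
  by case: ifP; rewrite ?subrr ?scale0r// subr0.
apply: le_trans (ler_wpM2l _ (hb _ Bf)) _; first by rewrite mulr_ge0 ?ltW.
by rewrite mulrAC /q mulrC divfK// gt_eqF// mulr_gt0.
Qed.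

End Decomposition.

(** * Sufficiency: the projections at the points of the spectrum *)

Section Backward.
Context {R : realType} {X : completeNormedModType (cplx R)}.
Local Notation C := (cplx R).
Local Notation meas := (@measurable _ (borelC R)).

Variables (A : operator X) (E : set C -> {linear X -> X}) (sE : spectral_measure E).
Let S := spectral_support E.
Hypothesis hG : forall f y, op_graph A (f, y) <-> is_spectral_integral E S id f y.
Variables (M : R) (M1 : 1 <= M).
Hypothesis hM : forall D f, meas D -> nrm (E D f) <= M * nrm f.
Hypothesis dA : densely_defined A.
Hypothesis cA : closed_op A.

Variable l : nat -> C.
Hypothesis l_bij : set_bij setT S l.

Let P n := E [set l n].

Lemma l_inj m n : l m = l n -> m = n.
Proof. by have [_ h _] := l_bij; apply: h; rewrite inE. Qed.

Lemma l_S n : S (l n).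
Proof. by have [h _ _] := l_bij; exact: h. Qed.

Lemma l_disj m n : m != n -> [set l m] `&` [set l n] = set0.
Proof. by move=> /eqP mn; apply/seteqP; split=> // x [/= -> /l_inj]. Qed.

Lemma point_orth n m f : P n (P m f) = if n == m then P n f else 0.
Proof.
rewrite /P -E_setI//; [|exact: set1_meas..].
have [->|nm] := eqVneq n m; first by rewrite setIid.
by rewrite l_disj// E_set0.
Qed.

Lemma point_sum f : \sum_(0 <= i < n) P i f @[n --> \oo] --> f.
Proof.
have h := @E_bigcup _ _ E sE (fun n => [set l n]) f (fun n => set1_meas (l n)).
have SE : \bigcup_n [set l n] = S.
  apply/seteqP; split=> [x [n _ ->]|x Sx]; first exact: l_S.
  by have [_ _ /(_ x Sx)[n _ <-]] := l_bij; exists n.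
have fE : E S f = f by rewrite -[RHS](E_setT sE f) -(E_suppI sE f measurableT) setTI.
by move: h; rewrite SE fE; apply; apply/trivIsetP => i j _ _; exact: l_disj.
Qed.

Lemma point_bound (r : seq nat) (a : nat -> C) (L : R) f : uniq r -> 0 < L ->
  (forall n, nrm (a n) <= L) -> nrm (\sum_(i <- r) a i *: P i f) <= 4 * M * L * nrm f.
Proof.
move=> ur L0 ha.
have := @E_comb_bound _ _ E sE M _ r (fun n => [set l n]) a L f hM ur.
rewrite mulrA (mulrAC 4); apply => //; last by move=> i j _ _; exact: l_disj.
by move=> i _; exact: set1_meas.
Qed.

Lemma graph_sum (u v : nat -> X) n : (forall i, op_graph A (u i, v i)) ->
  op_graph A (\sum_(0 <= i < n) u i, \sum_(0 <= i < n) v i).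
Proof.
move=> h; elim: n => [|n [d0 IH]].
  by rewrite !big_nil; split; [exact: dom_zero|exact: app0].
rewrite !big_nat_recr//=; have [/= d1 E1] := h n; rewrite /= in d0 IH.
split=> /=; rewrite addrC -[u n]scale1r; first exact: dom_lin.
by rewrite app_lin// scale1r E1 IH addrC.
Qed.

(** For the converse, the partial sums of the P_i f and of the l_i P_i f form pairs in the graph;
    they converge to f and g, and A is closed. *)
Lemma point_graph f g : op_graph A (f, g) <-> forall n, P n g = l n *: P n f.
Proof.
split=> [fg n|fg]; first exact: (E_set1_graph sE M1 hM hG (@l_S n) fg).
apply: (@graph_closed _ _ A cA (fun n => \sum_(0 <= i < n) P i f)
  (fun n => \sum_(0 <= i < n) l i *: P i f)).
- by move=> n; apply: graph_sum => i; exact: (graph_E_set1 sE M1 hM hG dA cA _ (@l_S i)).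
- exact: point_sum.
- rewrite (_ : (fun n => _) = (fun n => \sum_(0 <= i < n) P i g)); first exact: point_sum.
  by apply/funext => n; apply: eq_bigr => i _.
Qed.

Hypothesis l_cvg : complex.Re (l n) @[n --> \oo] --> -oo.
Hypothesis eig_fin : forall z, S z -> fin_dim (op_eigenspace A z).

Lemma compact_semigroup_exists : exists T : R -> {linear X -> X},
  [/\ C0_semigroup T, generator A T & immediately_compact T].
Proof.
have M4 : 0 < 4 * M by rewrite mulr_gt0// (lt_le_trans ltr01).
(* Re l_n <= 0 from some N on, and the sum of the |Re l_i| over i < N dominates the rest. *)
have [w [w0 hw]] : exists w : R, 0 <= w /\ forall n, complex.Re (l n) <= w.
  have := l_cvg => /cvgrNyPle /(_ 0)[N _ hN].
  exists (\sum_(0 <= i < N) `|complex.Re (l i)|).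
  split=> [|n]; first exact: sumr_ge0.
  have [nN|/hN] := ltnP n N; last by move/le_trans; apply; exact: sumr_ge0.
  apply: le_trans (ler_norm _) _.
  by rewrite big_mkord (bigD1 (Ordinal nN))//= lerDl sumr_ge0.
have Pc n : continuous (P n) by apply: E_continuous => //; exact: set1_meas.
have hT t : exists T : {linear X -> X}, 0 <= t -> forall n f,
    P n (T f) = cexp (ofreal t * l n) *: P n f.
  (* For negative t any operator will do. *)
  have [t0|t0] := leP 0 t; last by exists (P 0).
  have [|T hT] := multiplier_op M4 Pc point_orth point_sum point_bound
    (expR_gt0 (t * w)) (m := fun n => cexp (ofreal t * l n)).
    by move=> n; exact: nrm_cexp_le.
  by exists T.
have [T PT] := choice hT.
exists T; split.
- exact: (T_C0 M4 point_orth point_sum point_bound w0 hw PT).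
- exact: (T_generator M4 Pc point_orth point_sum point_bound w0 hw PT point_graph).
- apply: (T_compact M4 point_orth point_sum point_bound PT l_cvg) => n.
  have [s hs] := fin_dim_sub_lspan (eig_fin (@l_S n)); exists s => f; apply: hs.
  have [d1 d2] := graph_E_set1 sE M1 hM hG dA cA f (@l_S n).
  by split=> //; rewrite d2 subrr.
Qed.

End Backward.

Theorem theorem5p1 (R : realType) (X : completeNormedModType (cplx R))
    (infX : ~ fin_dim [set: X]) (A : operator X) (A_neq0 : nonzero_op A)
    (specA : scalar_type_spectral A) :
  (exists T : R -> {linear X -> X},
     [/\ C0_semigroup T, generator A T & immediately_compact T])
  <->
  [/\ (spectrum A #= [set: nat])%card,
      forall z, spectrum A z ->
        op_eigenvalue A z /\ fin_dim (op_eigenspace A z),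
      limit_point (spectrum A) = set0
    & forall l : nat -> cplx R, arrangement (spectrum A) l ->
        complex.Re (l n) @[n --> \oo] --> -oo].
Proof.
have [dA cA [E [sE SE hG]]] := specA; rewrite -SE in hG *.
have [M M1 hM] := E_bounded sE.
split=> [[T [hT gT cT]]|[cS eS _ lS]].
  have fS := spectrum_halfplane sE hG M1 hM dA hT gT cT.
  split.
  - apply: eq_card_nat; first exact: halfplanes_countable fS.
    exact: (spectrum_infinite sE hG M1 hM dA cA hT gT cT infX).
  - move=> z Sz; split; last exact: (eigenspace_fin_dim hT gT cT).
    exact: (spectrum_eigenvalue sE hG M1 hM dA cA hT gT cT Sz).
  - exact: halfplanes_limit_point.
  - by move=> l; exact: halfplanes_Re_cvg.
have /card_set_bijP[l lb] : ([set: nat] #= spectral_support E)%card by rewrite card_eq_sym.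
(* Arrangements are indexed from 1, while the enumeration l starts at 0; the shift is undone when
   the limit is transferred back to l. *)
have hl : arrangement (spectral_support E) (fun n => l n.-1).
  have [b1 b2 b3] := lb; split.
  - by move=> n _; exact: b1.
  - move=> [|m] [|n] /set_mem //= _ /set_mem //= _ h.
    by congr S; apply: b2; rewrite ?inE.
  - by move=> z /b3[n _ <-]; exists n.+1.
apply: (compact_semigroup_exists sE hG M1 hM dA cA lb); last by move=> z /eS[].
have /cvgrNyPle h := lS _ hl; apply/cvgrNyPle => c.
by have [N _ hN] := h c; exists N => // n Nn; exact: (hN n.+1 (leqW Nn)).
Qed.
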